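(* Let $\epsilon>0$ be arbitrary and let $$f_d(x):=\begin{cases}-\frac{\sqrt6}{\pi}\log\left(e^{-\frac{\pi}{\sqrt6}x}-1\right) & \text{if } x\in\left[-\frac{\sqrt6}{\pi}\log 2,\,0\right),\\[2pt] -\frac{\sqrt6}{\pi}\log\left(e^{\frac{\pi}{\sqrt6}x}-1\right) & \text{if } x\in\left(0,\,\frac{\sqrt6}{\pi}\log 2\right].\end{cases}$$ Then $$\lim_{n\to\infty}\frac{1}{d(n)}\cdot\#\left\{\lambda\in\mathscr{D}(n):\widetilde{\varphi}(\lambda)\subset N_\epsilon(f_d)\right\}=1,$$ where $\mathscr{D}(n)$ is the set of strongly unimodal sequences of size $n$ and $d(n)=\#\mathscr{D}(n)$.
   Context: A unimodal sequence of size $n$ is a finite sequence $\lambda=(\lambda_1,\dots,\lambda_s)$ of positive integers with $\sum_{j=1}^s\lambda_j=n$ such that for some $k$, $0<\lambda_1\le\dots\le\lambda_{k-1}\le\lambda_k\ge\lambda_{k+1}\ge\dots\ge\lambda_s>0$. Its peaks are $\lambda_k$ and any other parts equal to $\lambda_k$ (i.e. the parts of maximal size). It is strongly unimodal if all these inequalities are strict: $\lambda_1<\dots<\lambda_{k-1}<\lambda_k>\lambda_{k+1}>\dots>\lambda_s$. The diagram of $\lambda$ is the set of adjacent columns of unit squares in the plane standing on the $x$-axis, the $j$-th column having $\lambda_j$ squares, placed horizontally so that the left edge of the left-most peak column lies on the $y$-axis; that is, if $k$ is the smallest index with $\lambda_k$ maximal, the $j$-th column is $[j-k,j-k+1]\times[0,\lambda_j]$.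 The shape $\varphi(\lambda)$ is the upper border of the diagram: the polygonal path, consisting of horizontal and vertical segments, that starts at the left-most bottom corner of the diagram on the $x$-axis, follows the tops of the columns (with the vertical segments joining consecutive tops), and ends at the right-most bottom corner on the $x$-axis. The renormalized shape $\widetilde{\varphi}(\lambda)$ is obtained from $\varphi(\lambda)$ by rescaling both axes by $1/\sqrt n$, where $n$ is the size of $\lambda$. For a real function $f$ defined on a subset of $\mathbb{R}$, $N_\epsilon(f)$ is the set of points in the plane whose horizontal distance from the curve $y=f(x)$ is at most $\epsilon$ (i.e. points $(x_0,y_0)$ for which there is $x$ in the domain of $f$ with $f(x)=y_0$ and $|x-x_0|\le\epsilon$), together with the $\epsilon$-neighborhoods of the $x$-axis and of the $y$-axis (points at distance at most $\epsilon$ from one of the axes). *)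

(* Defs.v *)
From mathcomp Require Import all_boot all_order all_algebra.
From mathcomp Require Import finmap.
From mathcomp Require Import all_classical all_reals all_analysis.

Set Implicit Arguments.
Unset Strict Implicit.
Unset Printing Implicit Defensive.

Import Order.TTheory GRing.Theory Num.Theory.
Import numFieldNormedType.Exports.

Local Open Scope classical_set_scope.
Local Open Scope ring_scope.

(* Parts are indexed from 0 here: [k] is the position of the peak. *)
Definition strongly_unimodal (s : seq nat) : Prop :=
  all (ltn 0) s /\
  exists2 k : nat, (k < size s)%N &
    sorted ltn (take k.+1 s) /\ sorted gtn (drop k s).

Definition strongly_unimodal_seqs (n : nat) : set (seq nat) :=
  [set s | strongly_unimodal s /\ sumn s = n].

Lemma finite_strongly_unimodal_seqs (n : nat) :
  finite_set (strongly_unimodal_seqs n).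
Proof.
apply: (@sub_finite_set _ _
  [set map val (val b) | b in [set: n.-bseq 'I_n.+1]]); last first.
  exact/finite_image/finite_finset.
move=> s [[s_gt0 _] s_sum].
have size_le : (size s <= n)%N.
  rewrite -s_sum; elim: s s_gt0 {s_sum} => //= x s IHs /andP[x0 /IHs].
  by rewrite -add1n; exact: leq_add.
have part_le x : x \in s -> (x < n.+1)%N.
  rewrite ltnS -s_sum {s_gt0 s_sum size_le}.
  elim: s => //= y s IHs; rewrite inE => /orP[/eqP->|/IHs x_le].
    exact: leq_addr.
  exact: leq_trans x_le (leq_addl _ _).
have size_map_le : (size (map (@inord n) s) <= n)%N by rewrite size_map.
exists (Bseq size_map_le) => //=.
rewrite -map_comp -[RHS]map_id; apply/eq_in_map => x xs /=.
by rewrite inordK ?part_le.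
Qed.

(* [fset_set A] is empty when [A] is infinite; all the sets counted below are
   contained in the finite set [strongly_unimodal_seqs n]. *)
Definition num_seqs (A : set (seq nat)) : nat := #|` fset_set A |%fset.

Definition num_strongly_unimodal (n : nat) : nat := num_seqs (strongly_unimodal_seqs n).

Definition leftmost_peak (s : seq nat) : nat := index (\max_(x <- s) x)%N s.

Section Shape.
Variable R : realType.

(* Left edge of the [j]-th column; for [j = size s], right edge of the last. *)
Definition column_edge (s : seq nat) (j : nat) : R :=
  j%:R - (leftmost_peak s)%:R.

Definition column_top (s : seq nat) (j : nat) : set (R * R) :=
  [set p | column_edge s j <= p.1 <= column_edge s j.+1 /\
           p.2 = (nth 0%N s j)%:R].

(* The heights of the columns to the left and to the right of the [j]-th edge
   are [nth 0 (0 :: s) j] and [nth 0 s j]; there is height 0 outside of the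
   diagram, so [j = 0] and [j = size s] give the two extreme sides. *)
Definition vertical_step (s : seq nat) (j : nat) : set (R * R) :=
  let a := nth 0%N (0%N :: s) j in
  let b := nth 0%N s j in
  [set p | p.1 = column_edge s j /\ (minn a b)%:R <= p.2 <= (maxn a b)%:R].

Definition shape (s : seq nat) : set (R * R) :=
  \bigcup_(j in [set j | (j < size s)%N]) column_top s j `|`
  \bigcup_(j in [set j | (j <= size s)%N]) vertical_step s j.

Definition renormalized_shape (s : seq nat) : set (R * R) :=
  let r := Num.sqrt (sumn s)%:R in
  [set (p.1 / r, p.2 / r) | p in shape s].

(* The function considered is the restriction of [f] to [dom]. *)
Definition curve_nbhd (eps : R) (dom : set R) (f : R -> R) : set (R * R) :=
  [set p | exists2 x, dom x & f x = p.2 /\ `|x - p.1| <= eps] `|`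
  [set p | `|p.2| <= eps] `|`
  [set p | `|p.1| <= eps].

Definition f_d_dom : set R :=
  `[- (Num.sqrt 6 / pi * ln 2), 0[ `|` `]0, Num.sqrt 6 / pi * ln 2].

(* Only the values on [f_d_dom] are meaningful. *)
Definition f_d (x : R) : R :=
  if x < 0 then - (Num.sqrt 6 / pi) * ln (expR (- (pi / Num.sqrt 6) * x) - 1)
  else - (Num.sqrt 6 / pi) * ln (expR (pi / Num.sqrt 6 * x) - 1).

End Shape.

(* Main.v *)
Require Import Defs.
From mathcomp Require Import all_boot all_order all_algebra.
From mathcomp Require Import finmap.
From mathcomp Require Import all_classical all_reals all_analysis.
From mathcomp Require Import ring lra zify.

(** A strongly unimodal sequence of size [n] is the same thing as the pair
[(A, B)] of the sets of its parts to the left and to the right of the peak: the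
peak is what remains of [n].  Conversely, any pair whose total size leaves room
for a largest part comes from a sequence.  So the problem is about two
independent partitions into distinct parts.

Weigh a set of parts [A] by [exp (- t * sum A)].  The total weight factors as
the product of the [1 + exp (- t * j)], which means that under the corresponding
probability the parts are independent, [j] being present with probability
[exp (- t * j) / (1 + exp (- t * j))].  The mean number of parts larger than [x]
is then, up to a bounded error, [profile t x = ln (1 + exp (- t * x)) / t]
([sum_occupation_bounds]).  For [t = pi / sqrt (6 n)] and after rescaling by
[sqrt n], this is the inverse function of [f_d] ([f_d_profile]).  On the other
hand, a point of the shape at height [y] has an abscissa which is, up to sign
and an error of one, between the numbers of parts [> y] and [>= y] on its side
of the peak ([shape_counts]).  So the shape is close to the curve as soon as,
on both sides and for each of the at most [n + 1] integer thresholds, the number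
of larger parts is within [rho * sqrt n] of its mean ([shape_in_nbhd]).

A pair of total size at most [n] has weight at least [exp (- t * n)].  Hence a
Chernoff bound with a tilt of the large parts shows that at most
[exp (t * n) * Z ^ 2 * exp (- w * sqrt n)] sequences violate one of these
conditions, where [Z] is the total weight of a set and [w > 0]
([deviating_card_bound]).  It remains to see that [d(n)] is not smaller than
[exp (t * n) * Z ^ 2] by more than a factor [exp (o (sqrt n))].  This is where
the value of [t] matters: [t * ln Z] tends to [pi ^ 2 / 12] when [t] tends to
[0] ([log_gen_cvg]), so that [t = pi / sqrt (6 n)] minimizes
[t * n + 2 * ln Z] asymptotically, and the total size of a weighted pair then
concentrates near [n].  Chernoff bounds on both sides of a window below [n] give
[num_strongly_unimodal_lower].

The constant [pi ^ 2 / 12] is the sum of [(-1) ^ k / (k + 1) ^ 2]: truncations of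
the alternating series of [ln (1 + x)] bound it from both sides, and each of
their terms sums to a geometric series. *)

Import Order.TTheory GRing.Theory Num.Theory.
Import numFieldNormedType.Exports.

Local Open Scope classical_set_scope.
Local Open Scope ring_scope.

(** * The sum of the inverse squares, with signs *)

Lemma sin_between {R : realType} (x : R) :
  0 <= x <= pi -> x * cos x <= sin x <= x.
Proof.
move=> /andP[x0 xpi].
have [c cx] : exists2 c, c \in `[0, x]%R & sin x - sin 0 = cos c * (x - 0).
  apply: MVT_segment => //.
  by apply: continuous_subspaceT => y; exact: continuous_sin.
rewrite sin0 !subr0 => ->; move: cx; rewrite in_itv/= => /andP[c0 cx].
apply/andP; split; last by rewrite ler_piMl// cos_le1.
rewrite mulrC; apply: ler_wpM2r => //; rewrite le_eqVlt in cx.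
case/orP: cx => [/eqP->//|cx]; apply/ltW.
by rewrite ltr_cos ?in_itv/= ?c0 ?x0 ?xpi ?(le_trans (ltW cx)).
Qed.

Lemma inv_sqr_between {R : realType} (x : R) : 0 < x < pi / 2 ->
  (sin x ^+ 2)^-1 - 1 <= (x ^+ 2)^-1 <= (sin x ^+ 2)^-1.
Proof.
move=> /andP[x0 xpi]; have xpi' : x <= pi.
  by rewrite (le_trans (ltW xpi))// ler_pdivrMr// ler_peMr// ?pi_ge0// ler1n.
have /andP[h1 h2] := @sin_between R x ltac:(by rewrite (ltW x0)).
have s0 : 0 < sin x by apply: sin_gt0_pihalf; rewrite x0.
have c0 : 0 < cos x.
  apply: cos_gt0_pihalf; rewrite xpi andbT (lt_trans _ x0)//.
  by rewrite oppr_lt0 divr_gt0 ?pi_gt0.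
apply/andP; split; last first.
  by rewrite lef_pV2 ?posrE ?exprn_gt0// ler_pXn2r// nnegrE ltW.
have -> : (sin x ^+ 2)^-1 - 1 = (cos x / sin x) ^+ 2.
  by rewrite expr_div_n cos2sin2 mulrBl mul1r mulfV// expf_neq0// gt_eqF.
rewrite -exprVn ler_pXn2r// ?nnegrE ?divr_ge0 ?invr_ge0 ?(ltW x0) ?(ltW s0) ?(ltW c0)//.
by rewrite ler_pdivrMr// mulrC ler_pdivlMr// mulrC.
Qed.

(** Halving the angles of level [n], and taking the complements to [pi / 2] of these
halves, gives the angles of level [n + 1]; this is the induction step of
[sum_inv_sqr_sin]. *)
Definition odd_angle {R : realType} (n k : nat) : R :=
  (2 * k + 1)%:R * pi / 2 ^+ n.+2.

(** Both terms on the right are brought to the common denominator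
[sin (x / 2) ^ 2 * cos (x / 2) ^ 2 = sin x ^ 2 / 4], the numerator being [1]. *)
Lemma inv_sqr_sin_half {R : realType} (x : R) : sin x != 0 ->
  4 * (sin x ^+ 2)^-1 =
  (sin (x / 2) ^+ 2)^-1 + (sin (pi / 2 - x / 2) ^+ 2)^-1.
Proof.
move=> sx; have -> : sin (pi / 2 - x / 2) = cos (x / 2).
  by rewrite sinB sin_pihalf cos_pihalf mul1r mul0r subr0.
have sxE : sin x = 2 * cos (x / 2) * sin (x / 2).
  by rewrite {1}(_ : x = (x / 2) *+ 2) ?sin_mulr2n; [ring | field].
move: sx; rewrite sxE !mulf_eq0 !negb_or => /andP[/andP[_ c0] s0].
rewrite [X in _ = X](_ : _ = (cos (x / 2) ^+ 2 + sin (x / 2) ^+ 2) /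
    (cos (x / 2) ^+ 2 * sin (x / 2) ^+ 2)); last by field; rewrite c0 s0.
by rewrite cos2Dsin2; field; rewrite c0 s0.
Qed.

Lemma odd_angle_itv {R : realType} n k : (k < 2 ^ n)%N ->
  0 < (odd_angle n k : R) < pi / 2.
Proof.
move=> kn; rewrite /odd_angle; apply/andP; split.
  by rewrite divr_gt0 ?exprn_gt0// mulr_gt0 ?pi_gt0// ltr0n addn1.
rewrite ltr_pdivrMr ?exprn_gt0// exprS mulrA divfK// mulrC.
rewrite ltr_pM2l ?pi_gt0// -natrX ltr_nat expnS; lia.
Qed.

Lemma sum_inv_sqr_sin {R : realType} n :
  \sum_(k < 2 ^ n) (sin (odd_angle n k) ^+ 2)^-1 = 2 * 4 ^+ n :> R.
Proof.
elim: n => [|n IH].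
  rewrite expn0 big_ord1 /odd_angle muln0 add0n mul1r.
  have := cos2Dsin2 (pi / 4 : R).
  have -> : cos (pi / 4) = sin (pi / 4) :> R.
    rewrite -[in LHS](_ : pi / 2 - pi / 4 = pi / 4) ?cosB; last by field.
    by rewrite sin_pihalf cos_pihalf mul1r mul0r add0r.
  have -> : 2 ^+ 2 = 4 :> R by rewrite -natrX.
  move=> h; have -> : sin (pi / 4) ^+ 2 = 2^-1 :> R by lra.
  by rewrite invrK expr0 mulr1.
have e2 : (2 ^ n.+1 = 2 ^ n + 2 ^ n)%N by rewrite expnS mul2n addnn.
rewrite exprS mulrCA -IH mulr_sumr.
under [RHS]eq_bigr => k _.
  rewrite inv_sqr_sin_half; last first.
    have /andP[h0 h1] := @odd_angle_itv R n k (ltn_ord k).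
    by rewrite gt_eqF// sin_gt0_pihalf// h0.
  over.
rewrite big_split/= -(big_mkord xpredT (fun k => (sin (odd_angle n.+1 k) ^+ 2)^-1)).
rewrite (@big_cat_nat _ _ _ (2 ^ n)) ?e2 ?leq_addr//=; congr (_ + _).
  rewrite big_mkord; apply: eq_bigr => k _; congr ((sin _ ^+ 2)^-1).
  by rewrite /odd_angle (exprSr _ n.+2) invfM !mulrA.
rewrite -{1}[(2 ^ n)%N]add0n big_addn addnK big_mkord (reindex_inj rev_ord_inj)/=.
apply: eq_bigr => k _; congr ((sin _ ^+ 2)^-1).
rewrite /odd_angle.
have kn := ltn_ord k.
have -> : (2 * (2 ^ n - k.+1 + (2 ^ n)) + 1)%:R = 2 ^+ n.+2 - (2 * k + 1)%:R :> R.
  rewrite -natrX -natrB; last by rewrite !expnS; lia.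
  congr (_%:R); rewrite !expnS; lia.
by rewrite [2 ^+ n.+3]exprS; field; rewrite expf_neq0.
Qed.

(** Since [1 / sin x ^ 2 - 1 <= 1 / x ^ 2 <= 1 / sin x ^ 2] on [(0, pi / 2)], the
exact sum of the [1 / sin x ^ 2] over [2 ^ n] angles proportional to the odd
numbers determines the sum of their inverse squares with error [2 ^ n], which
is small relative to [4 ^ n]. *)
Lemma sum_odd_inv_sqr_bounds {R : realType} n :
  pi ^+ 2 / 8 * (1 - (2 ^+ n.+1)^-1)
    <= \sum_(k < 2 ^ n) ((2 * k + 1)%:R ^+ 2 : R)^-1 <= (pi ^+ 2 / 8 : R).
Proof.
set O := \sum_(k < _) _.
have OE : \sum_(k < 2 ^ n) ((odd_angle n k : R) ^+ 2)^-1 = 16 * 4 ^+ n / pi ^+ 2 * O.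
  rewrite mulr_sumr; apply: eq_bigr => k _; rewrite /odd_angle.
  have -> : (4 : R) ^+ n = (2 ^+ n) ^+ 2 by rewrite exprAC; congr (_ ^+ n); rewrite -natrX.
  rewrite !exprS; move: (@pi R) (lt0r_neq0 (pi_gt0 R)) => p p0; field.
  by rewrite p0 expf_neq0//= -natrM natr1 pnatr_eq0.
have lo : 2 * 4 ^+ n - 2 ^+ n <= 16 * 4 ^+ n / pi ^+ 2 * O.
  rewrite -OE -sum_inv_sqr_sin.
  have -> : 2 ^+ n = \sum_(k < 2 ^ n) (1 : R) by rewrite sumr_const card_ord natrX.
  rewrite -sumrB; apply: ler_sum => k _.
  by have /inv_sqr_between/andP[] := @odd_angle_itv R n k (ltn_ord k).
have hi : 16 * 4 ^+ n / pi ^+ 2 * O <= 2 * 4 ^+ n.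
  rewrite -OE -sum_inv_sqr_sin; apply: ler_sum => k _.
  by have /inv_sqr_between/andP[] := @odd_angle_itv R n k (ltn_ord k).
have p0 : 0 < pi ^+ 2 :> R by rewrite exprn_gt0// pi_gt0.
have e0 : 0 < 16 * 4 ^+ n / pi ^+ 2 :> R by rewrite divr_gt0// mulr_gt0// exprn_gt0.
apply/andP; split.
  rewrite -(ler_pM2l e0); apply: le_trans lo; rewrite le_eqVlt; apply/orP; left.
  have -> : (4 : R) ^+ n = (2 ^+ n) ^+ 2 by rewrite exprAC; congr (_ ^+ n); rewrite -natrX.
  apply/eqP; rewrite (exprS 2 n); move: (@pi R) (lt0r_neq0 (pi_gt0 R)) => p p'0; field.
  by rewrite expf_neq0//= p'0.
rewrite -(ler_pM2l e0); apply: le_trans hi _; rewrite le_eqVlt; apply/orP; left.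
by apply/eqP; move: (@pi R) (lt0r_neq0 (pi_gt0 R)) => p p'0; field.
Qed.

Lemma le_sum_ord {R : numDomainType} (f : nat -> R) a b : (forall k, 0 <= f k) ->
  (a <= b)%N -> \sum_(k < a) f k <= \sum_(k < b) f k.
Proof.
move=> f0 ab; rewrite -!(big_mkord xpredT f) [leRHS](big_cat_nat (leq0n a) ab)/=.
by rewrite lerDl sumr_ge0.
Qed.

Lemma sum_odd_inv_sqr_cvg {R : realType} :
  \sum_(k < m) ((2 * k + 1)%:R ^+ 2 : R)^-1 @[m --> \oo] --> pi ^+ 2 / 8.
Proof.
have mono a b : (a <= b)%N -> \sum_(k < a) ((2 * k + 1)%:R ^+ 2 : R)^-1
    <= \sum_(k < b) ((2 * k + 1)%:R ^+ 2)^-1.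
  apply: (le_sum_ord (fun k => ((2 * k + 1)%:R ^+ 2)^-1)) => k.
  by rewrite invr_ge0 exprn_ge0.
have hi m : \sum_(k < m) ((2 * k + 1)%:R ^+ 2 : R)^-1 <= pi ^+ 2 / 8.
  have := mono m _ (ltnW (ltn_expl m (isT : (1 < 2)%N))).
  by move/le_trans; apply; have /andP[] := @sum_odd_inv_sqr_bounds R m.
apply/cvgrPdist_le => e e0.
have : pi ^+ 2 / 8 * (2 ^+ n.+1)^-1 @[n --> \oo] --> (0 : R).
  rewrite -[X in _ --> X](mulr0 (pi ^+ 2 / 8)); apply: cvgMr.
  under eq_fun do rewrite -exprVn.
  apply: (cvg_comp (S : nat -> nat) (fun n => (2^-1 : R) ^+ n)).
    by apply/cvgnyPge => A; exists A => // n /= /leqW.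
  by apply: cvg_expr; rewrite ger0_norm ?invf_lt1 ?ltr1n.
move/cvgrPdistC_le => /(_ e e0)[n _ /(_ n (leqnn n))]; rewrite /= subr0 => hn.
exists (2 ^ n)%N => // m /= nm; rewrite ger0_norm ?subr_ge0 ?hi//.
rewrite lerBlDr addrC -lerBlDr; apply: le_trans (mono _ _ nm).
have /andP[+ _] := @sum_odd_inv_sqr_bounds R n; apply: le_trans.
rewrite mulrBr mulr1 lerB//; exact: le_trans (ler_norm _) hn.
Qed.

Lemma half_cvg : n./2 @[n --> \oo] --> \oo.
Proof. by apply/cvgnyPge => A; exists A.*2 => // n /= h; rewrite geq_half_double. Qed.

Lemma uphalf_cvg : uphalf n @[n --> \oo] --> \oo.
Proof.
apply/cvgnyPge => A; exists A.*2 => // n /= h.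
by rewrite (leq_trans _ (half_leq (leqnSn n)))// geq_half_double.
Qed.

(** With [c = 1] this separates the even from the odd indices of a sum, with
[c = -1] it does the same for an alternating sum. *)
Lemma sum_parity_split {R : pzRingType} (c : R) (f : nat -> R) m :
  \sum_(k < m) c ^+ odd k * f k =
  \sum_(k < uphalf m) f (2 * k)%N + c * \sum_(k < m./2) f (2 * k + 1)%N.
Proof.
elim: m => [|m IH]; first by rewrite /= !big_ord0 mulr0 addr0.
rewrite big_ord_recr [LHS]/= IH -[uphalf m.+1]/(m./2.+1) -[m.+1./2]/(uphalf m).
rewrite uphalf_half -[in f m](odd_double_half m) -mul2n.
case: (odd m); last by rewrite !add0n expr0 mul1r big_ord_recr/= addrAC.
by rewrite !add1n expr1 [X in _ = _ + c * X]big_ord_recr/= mulrDr addrA addn1.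
Qed.

Lemma sum_inv_sqr_half {R : realType} m :
  \sum_(k < m) ((2 * k + 1).+1%:R ^+ 2 : R)^-1
  = (\sum_(k < m) (k.+1%:R ^+ 2)^-1) / 4.
Proof.
rewrite mulr_suml; apply: eq_bigr => k _.
have -> : (2 * k + 1).+1 = (2 * k.+1)%N by lia.
by rewrite natrM exprMn invfM mulrC; congr (_ * _^-1); rewrite -natrX.
Qed.

(** The terms of even rank reproduce a quarter of the sum, so its limit [l]
satisfies [l = pi ^ 2 / 8 + l / 4]. *)
Lemma sum_inv_sqr_cvg {R : realType} :
  \sum_(k < m) (k.+1%:R ^+ 2 : R)^-1 @[m --> \oo] --> pi ^+ 2 / 6.
Proof.
set S := fun m : nat => \sum_(k < m) (k.+1%:R ^+ 2 : R)^-1.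
set O := fun m : nat => \sum_(k < m) ((2 * k + 1)%:R ^+ 2 : R)^-1.
have SE m : S m = O (uphalf m) + S m./2 / 4.
  transitivity (\sum_(k < m) (1 : R) ^+ odd k * (k.+1%:R ^+ 2)^-1).
    by apply: eq_bigr => k _; rewrite expr1n mul1r.
  rewrite (sum_parity_split 1 (fun k => (k.+1%:R ^+ 2 : R)^-1)) mul1r.
  rewrite sum_inv_sqr_half /O; congr (_ + _).
  by apply: eq_bigr => k _; rewrite addn1.
have Smono : nondecreasing_seq S.
  move=> a b; apply: (le_sum_ord (fun k => (k.+1%:R ^+ 2)^-1)) => k.
  by rewrite invr_ge0 exprn_ge0.
have Omono : nondecreasing_seq O.
  move=> a b; apply: (le_sum_ord (fun k => ((2 * k + 1)%:R ^+ 2)^-1)) => k.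
  by rewrite invr_ge0 exprn_ge0.
have Ocvg := @sum_odd_inv_sqr_cvg R.
have Ole m : O m <= pi ^+ 2 / 8.
  by rewrite -(cvg_lim _ Ocvg)//; apply: nondecreasing_cvgn_le => //;
    apply/cvg_ex; eexists; exact: Ocvg.
have Scvg : cvgn S.
  apply: nondecreasing_is_cvgn => //; exists (pi ^+ 2 / 6) => _ [m _ <-].
  have : S m <= pi ^+ 2 / 8 + S m / 4.
    by rewrite {1}SE lerD// ler_pM2r//; apply: Smono; have h : (m./2 <= m)%N by lia; exact: h.
  lra.
suff <- : limn S = pi ^+ 2 / 6 by [].
have hlf : S m./2 @[m --> \oo] --> limn S by apply: cvg_comp Scvg; exact: half_cvg.
have uph : O (uphalf m) @[m --> \oo] --> pi ^+ 2 / 8.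
  by apply: cvg_comp Ocvg; exact: uphalf_cvg.
have : S m @[m --> \oo] --> pi ^+ 2 / 8 + limn S / 4.
  under eq_fun do rewrite SE.
  by apply: cvgD => //; apply: cvgMl.
move/cvg_lim => /(_ (@Rhausdorff _)) /= h.
suff : limn S = pi ^+ 2 / 8 + limn S / 4 by lra.
exact: h.
Qed.

Lemma alternating_sum_inv_sqr_cvg {R : realType} :
  \sum_(k < m) (-1) ^+ k / (k.+1%:R ^+ 2 : R) @[m --> \oo] --> pi ^+ 2 / 12.
Proof.
under eq_fun => m.
  under eq_bigr => k _ do rewrite -signr_odd.
  rewrite (sum_parity_split (-1) (fun k => (k.+1%:R ^+ 2 : R)^-1)) mulN1r sum_inv_sqr_half.
  under eq_bigr => k _ do rewrite -[(2 * k).+1]addn1.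
  over.
have -> : pi ^+ 2 / 12 = pi ^+ 2 / 8 - pi ^+ 2 / 6 / 4 :> R by lra.
apply: cvgB.
  by exact: (cvg_comp _ _ uphalf_cvg sum_odd_inv_sqr_cvg).
by apply: cvgMl; exact: (cvg_comp _ _ half_cvg sum_inv_sqr_cvg).
Qed.

(** * Asymptotics of the generating function of partitions into distinct parts *)

(** The difference vanishes at [0] and its derivative is
[(- x) ^ m / (1 + x)], of constant sign; the mean value theorem concludes. *)
Lemma ln1D_alternating {R : realType} (x : R) m : 0 <= x ->
  0 <= (-1) ^+ m * (ln (1 + x) - \sum_(k < m) (-1) ^+ k / k.+1%:R * x ^+ k.+1).
Proof.
move=> x0.
pose p : {poly R} := \sum_(k < m) ((-1) ^+ k / k.+1%:R) *: 'X^(k.+1).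
have pE y : p.[y] = \sum_(k < m) (-1) ^+ k / k.+1%:R * y ^+ k.+1.
  by rewrite /p horner_sum; apply: eq_bigr => k _; rewrite hornerZ hornerXn.
have dpE y : (1 + y) * (p^`()).[y] = 1 - (- y) ^+ m.
  have -> : (p^`()).[y] = \sum_(k < m) (- y) ^+ k.
    rewrite /p raddf_sum horner_sum; apply: eq_bigr => k _ /=.
    rewrite derivZ derivXn hornerZ hornerMn hornerXn -[X in _ * X]mulr_natl.
    rewrite mulrA divfK ?pnatr_eq0//.
    by rewrite (exprNn y).
  have -> : 1 + y = - (- y - 1) by ring.
  by rewrite mulNr -subrX1 opprB.
have df (y : R) : 0 <= y ->
    is_derive y (1 : R) (fun z : R => ln (1 + z) - p.[z]) ((- y) ^+ m / (1 + y)).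
  move=> y0; have y1 : 0 < 1 + y by rewrite ltr_wpDr.
  have d1 : is_derive y (1 : R) (fun z : R => 1 + z) 1.
    by rewrite -[X in is_derive _ _ _ X]add0r; apply: is_deriveD.
  have d2 : is_derive (1 + y) (1 : R) (@ln R) (1 + y)^-1 by exact: is_derive1_ln.
  have d3 := is_derive1_comp d2 d1.
  apply: (is_derive_eq (is_deriveB d3 (is_derive_poly p y))); rewrite mulr1.
  apply: (mulfI (lt0r_neq0 y1)); rewrite mulrBr dpE mulfV ?gt_eqF//.
  by rewrite mulrCA mulfV ?gt_eqF// mulr1 opprB addrC subrK.
have [c] : exists2 c, c \in `[0, x]%R &
    (ln (1 + x) - p.[x]) - (ln (1 + 0) - p.[0]) = (- c) ^+ m / (1 + c) * (x - 0).
  apply: (@MVT_segment _ (fun y => ln (1 + y) - p.[y]) (fun y => (- y) ^+ m / (1 + y))) => //.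
    by move=> y; rewrite in_itv/= => /andP[/ltW y0 _]; exact: df.
  apply: continuous_in_subspaceT => y; rewrite inE /= in_itv/= => /andP[y0 _].
  by apply/differentiable_continuous/derivable1_diffP; have [] := df y y0.
rewrite in_itv/= => /andP[c0 _].
have -> : p.[0] = 0 by rewrite pE big1// => k _; rewrite expr0n mulr0.
rewrite addr0 ln1 !subr0 pE => ->.
rewrite (exprNn c) !mulrA -exprD addnn -mul2n exprM sqrrN !expr1n mul1r.
by rewrite mulr_ge0// divr_ge0// ?exprn_ge0// addr_ge0.
Qed.

(** The sum is [exp (- s) * (1 - exp (- s * M)) / (1 - exp (- s))], and
[s * exp (- s) <= 1 - exp (- s) <= s]. *)
Lemma geometric_sum_bounds {R : realType} (s : R) M : 0 < s ->
  expR (- s) * (1 - expR (- (s * M%:R)))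
    <= s * \sum_(i < M) expR (- (s * i.+1%:R)) <= 1 - expR (- (s * M%:R)).
Proof.
move=> s0; set r := expR (- s).
have rX i : expR (- (s * i%:R)) = r ^+ i by rewrite -mulNr expRM_natr.
under eq_bigr do rewrite rX; rewrite rX.
set G := \sum_(_ < _) _.
have GE : (1 - r) * G = r * (1 - r ^+ M).
  rewrite -[1 - r ^+ M]opprB subrX1 -mulNr opprB mulrCA; congr (_ * _).
  by rewrite mulr_sumr; apply: eq_bigr => i _; rewrite exprS.
have r0 : 0 < r := expR_gt0 _.
have r1 : r < 1 by rewrite expR_lt1 oppr_lt0.
have rs : 1 - r <= s by have := expR_ge1Dx (- s); rewrite -/r; lra.
have sr : s * r <= 1 - r.
  have := expR_ge1Dx s; rewrite -(ler_pM2r r0) -expRD subrr expR0 mulrDl mul1r; lra.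
have G0 : 0 <= G by apply: sumr_ge0 => i _; rewrite exprn_ge0 ?ltW.
rewrite -GE ler_wpM2r//= -(ler_pM2l r0) -GE mulrA ler_wpM2r//.
by rewrite mulrC.
Qed.

Lemma geometric_sum_cvg {R : realType} (t : nat -> R) (M : nat -> nat) (c : R) :
  (forall n, 0 < t n) -> 0 < c -> t n @[n --> \oo] --> 0 ->
  t n * (M n)%:R @[n --> \oo] --> +oo ->
  t n * \sum_(i < M n) expR (- (c * t n * i.+1%:R)) @[n --> \oo] --> c^-1.
Proof.
move=> t0 c0 tcvg tM.
have e0 : expR (- (c * t n * (M n)%:R)) @[n --> \oo] --> (0 : R).
  apply: (cvg_comp (fun n => c * t n * (M n)%:R) (fun x : R => expR (- x))); last exact: cvgr_expR.
  apply/cvgryPge => A; have /cvgryPge/(_ (A / c)) := tM.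
  by apply: filterS => n; rewrite ler_pdivrMr// mulrC mulrA.
have e1 : expR (- (c * t n)) @[n --> \oo] --> (1 : R).
  rewrite -(expR0 R); apply: continuous_cvg; first exact: continuous_expR.
  by rewrite -oppr0 -[X in _ --> - X](mulr0 c); apply: cvgN; apply: cvgMr.
have key : c * t n * \sum_(i < M n) expR (- (c * t n * i.+1%:R)) @[n --> \oo] --> (1 : R).
  have h : 1 - expR (- (c * t n * (M n)%:R)) @[n --> \oo] --> (1 : R).
    by rewrite -[X in _ --> X]subr0; apply: cvgB => //; exact: cvg_cst.
  apply: (squeeze_cvgr _ _ h).
    by near=> n; apply: geometric_sum_bounds; rewrite mulr_gt0.
  by rewrite -[X in _ --> X]mulr1; apply: cvgM.
have : c^-1 * (c * t n * \sum_(i < M n) expR (- (c * t n * i.+1%:R)))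
    @[n --> \oo] --> c^-1 * 1 by apply: cvgMr.
by rewrite mulr1; under eq_fun do rewrite -(mulrA c) mulKf ?gt_eqF//.
Unshelve. all: end_near. Qed.

(** The logarithm of the generating function of the partitions into distinct parts
at most [M], taken at [exp (- t)]. *)
Definition log_gen {R : realType} (t : R) (M : nat) : R :=
  \sum_(i < M) ln (1 + expR (- (t * i.+1%:R))).

(** Only finite sums are exchanged: for a fixed even (odd) number of terms of the
series of [ln (1 + x)] one gets a lower (upper) bound, whose limit is a partial
sum of [(-1) ^ k / (k + 1) ^ 2]: one factor [1 / (k + 1)] comes from the series
and one from the geometric sum of the [exp (- (k + 1) * t * j)]. *)
Lemma log_gen_cvg {R : realType} (t : nat -> R) (M : nat -> nat) :
  (forall n, 0 < t n) -> t n @[n --> \oo] --> 0 ->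
  t n * (M n)%:R @[n --> \oo] --> +oo ->
  t n * log_gen (t n) (M n) @[n --> \oo] --> pi ^+ 2 / 12.
Proof.
move=> t0 tcvg tM.
(* [log_gen] with the logarithm replaced by [m] terms of its series. *)
pose P n m : R := \sum_(k < m) (-1) ^+ k / k.+1%:R *
  (t n * \sum_(i < M n) expR (- (k.+1%:R * t n * i.+1%:R))).
have Pcvg m : P n m @[n --> \oo] --> \sum_(k < m) (-1) ^+ k / (k.+1%:R ^+ 2 : R).
  rewrite /P; elim: m => [|m IH].
    by rewrite big_ord0; under eq_fun do rewrite big_ord0; exact: cvg_cst.
  rewrite big_ord_recr; under eq_fun do rewrite big_ord_recr.
  apply: cvgD => //=; rewrite expr2 invfM mulrA; apply: cvgMr.
  exact: geometric_sum_cvg.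
have PE n m : 0 <= (-1) ^+ m * (t n * log_gen (t n) (M n) - P n m).
  have -> : P n m = t n * \sum_(i < M n) \sum_(k < m)
      (-1) ^+ k / k.+1%:R * expR (- (t n * i.+1%:R)) ^+ k.+1.
    rewrite exchange_big mulr_sumr; apply: eq_bigr => k _ /=.
    rewrite mulrCA mulr_sumr; congr (_ * _); apply: eq_bigr => i _.
    by rewrite -expRM_natl mulrN !mulrA.
  rewrite -mulrBr mulrCA mulr_ge0 ?(ltW (t0 n))// /log_gen -sumrB mulr_sumr.
  by apply: sumr_ge0 => i _; apply: ln1D_alternating; rewrite expR_ge0.
apply/cvgrPdist_le => e e0.
have e20 : 0 < e / 2 by rewrite divr_gt0.
have /cvgrPdist_le/(_ _ e20)[m _ hm] := @alternating_sum_inv_sqr_cvg R.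
have := hm (2 * m)%N; have := hm (2 * m).+1; rewrite /=.
move=> /(_ ltac:(lia)) + /(_ ltac:(lia)).
have := Pcvg (2 * m)%N; have := Pcvg (2 * m).+1.
move: (\sum_(k < _) _) (\sum_(k < _) _) => Ae Ao.
move=> /cvgrPdist_le/(_ _ e20) ho /cvgrPdist_le/(_ _ e20) he hAo hAe.
near=> n.
have : `|Ao - P n (2 * m).+1| <= e / 2 by near: n.
have : `|Ae - P n (2 * m)%N| <= e / 2 by near: n.
have := PE n (2 * m)%N; have := PE n (2 * m).+1.
rewrite exprS exprM sqrrN !expr1n.
move: hAo hAe; rewrite !ler_norml; lra.
Unshelve. all: end_near. Qed.

(** * The limiting profile and the mean number of large parts *)

(** The asymptotic number of parts larger than [x] in a random set of parts of
weight [exp (- t * size)]. *)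
Definition profile {R : realType} (t x : R) : R := ln (1 + expR (- (t * x))) / t.

(** The probability that the part [x] is present, minus the derivative of
[profile t]. *)
Definition occupation {R : realType} (t x : R) : R :=
  expR (- (t * x)) / (1 + expR (- (t * x))).

Lemma occupation_itv {R : realType} (t x : R) : 0 < occupation t x < 1.
Proof.
have e0 := expR_gt0 (- (t * x)); have e1 : 0 < 1 + expR (- (t * x)) by rewrite addr_gt0.
by rewrite /occupation divr_gt0//= ltr_pdivrMr// mul1r ltrDr.
Qed.

(** Jensen's inequality for the exponential and the weights [1 / (1 + a)] and
[a / (1 + a)] at the points [0] and [s].  With [s = t] and [s = - t] it replaces
the comparison of [occupation t] with its integrals over unit intervals. *)
Lemma occupation_le_ln_ratio {R : realType} (a s : R) : 0 < a ->
  s * (a / (1 + a)) <= ln (1 + a * expR s) - ln (1 + a).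
Proof.
move=> a0; have a1 : 0 < 1 + a by rewrite addr_gt0.
have b1 : 0 < 1 + a * expR s by rewrite addr_gt0// mulr_gt0// expR_gt0.
set p := a / (1 + a); have pE : p * (1 + a) = a by rewrite divfK ?gt_eqF.
rewrite -ln_div ?posrE// -ler_expR lnK ?posrE ?divr_gt0// ler_pdivlMr//.
have E0 := expR_gt0 (s * p).
have h1 : expR (s * p) * (1 - s * p) <= 1.
  by rewrite -[leRHS](expRxMexpNx_1 (s * p)) ler_pM2l//; exact: expR_ge1Dx.
have h2 : expR (s * p) * (1 + (s - s * p)) <= expR s.
  rewrite -[leRHS](_ : expR (s * p) * expR (s - s * p) = _); last first.
    by rewrite -expRD addrC subrK.
  by rewrite ler_pM2l//; exact: expR_ge1Dx.
have h3 : a * (expR (s * p) * (1 + (s - s * p))) <= a * expR s by rewrite ler_pM2l.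
suff -> : expR (s * p) * (1 + a) =
  expR (s * p) * (1 - s * p) + a * (expR (s * p) * (1 + (s - s * p))) by exact: lerD.
have -> : expR (s * p) * (1 - s * p) + a * (expR (s * p) * (1 + (s - s * p)))
  = expR (s * p) * (1 + a + s * (a - p * (1 + a))) by ring.
by rewrite pE subrr mulr0 addr0.
Qed.

Lemma profile_step {R : realType} (t x : R) : 0 < t ->
  profile t x - profile t (x + 1) <= occupation t x <= profile t (x - 1) - profile t x.
Proof.
move=> t0; have a0 := expR_gt0 (- (t * x)).
have := occupation_le_ln_ratio _ (- t) a0; have := occupation_le_ln_ratio _ t a0.
rewrite -!expRD -/(occupation t x) /profile -!mulrBl ler_pdivrMr// ler_pdivlMr//.
have -> : - (t * x) + t = - (t * (x - 1)) by ring.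
have -> : - (t * x) + - t = - (t * (x + 1)) by ring.
move=> h1 h2; rewrite [occupation t x * t]mulrC; apply/andP; split; last by exact: h1.
by move: h2; rewrite mulNr lerNl opprB.
Qed.

Lemma profile_ge0 {R : realType} (t x : R) : 0 < t -> 0 <= profile t x.
Proof. by move=> t0; rewrite divr_ge0 ?(ltW t0)// ln_ge0// lerDl expR_ge0. Qed.

Lemma le_profile {R : realType} (t x y : R) : 0 < t -> x <= y ->
  profile t y <= profile t x.
Proof.
move=> t0 xy; rewrite ler_pM2r ?invr_gt0//.
by rewrite ler_ln ?posrE ?addr_gt0 ?expR_gt0// lerD2l ler_expR lerN2 ler_pM2l.
Qed.

Lemma profile_le_expR {R : realType} (t x : R) : 0 < t ->
  profile t x <= expR (- (t * x)) / t.
Proof.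
move=> t0; rewrite ler_pM2r ?invr_gt0//; apply: le_ln1Dx.
by rewrite (lt_trans _ (expR_gt0 _))// oppr_lt0.
Qed.

Lemma sum_occupation_bounds {R : realType} (t : R) i n : 0 < t -> (i <= n)%N ->
  profile t i.+1%:R - profile t n.+1%:R
    <= \sum_(i <= j < n) occupation t j.+1%:R <= profile t i%:R.
Proof.
move=> t0 le_in; apply/andP; split.
  rewrite -[leLHS]opprB -(telescope_sumr (fun j : nat => profile t j.+1%:R)) //.
  rewrite -sumrN; apply: ler_sum => j _; rewrite opprB.
  by have /andP[] := profile_step t j.+1%:R t0; rewrite natr1.
apply: (@le_trans _ _ (profile t i%:R - profile t n%:R)); last first.
  by rewrite gerBl profile_ge0.
rewrite -[leRHS]opprB -(telescope_sumr (fun j : nat => profile t j%:R)) //.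
rewrite -sumrN; apply: ler_sum => j _; rewrite opprB.
have /andP[_] := profile_step t j.+1%:R t0.
by rewrite -{2}[j.+1]addn1 natrD addrK.
Qed.

(** * Exponential tilting for pairs of sets of parts *)

Definition parts_sum {n} (A : {set 'I_n}) : nat := (\sum_(j in A) j.+1)%N.

Definition parts_above {n} (i : nat) (A : {set 'I_n}) : nat :=
  #|[set j in A | (i <= j)%N]%SET|.

Lemma sum_over_sets {R : comPzRingType} n (w : 'I_n -> R) :
  \sum_(A : {set 'I_n}) \prod_(j in A) w j = \prod_j (1 + w j).
Proof.
under [RHS]eq_bigr do rewrite addrC.
rewrite bigA_distr; apply: eq_bigr => A _; exact: big_mkcond.
Qed.

(** The weight is multiplicative over the parts, so the sum is a product; the factor
of a tilted part is [1 + (exp v - 1) * p] times the untilted one, where [p] is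
its probability, and this is at most [exp ((exp v - 1) * p)]. *)
Lemma tilted_sum_bound {R : realType} n i (t v : R) :
  \sum_(A : {set 'I_n}) expR (- (t * (parts_sum A)%:R) + v * (parts_above i A)%:R)
  <= expR (log_gen t n + (expR v - 1) * \sum_(i <= j < n) occupation t j.+1%:R).
Proof.
pose w (j : 'I_n) : R := expR (- (t * j.+1%:R) + if (i <= j)%N then v else 0).
under eq_bigr => A _.
  rewrite (_ : expR _ = \prod_(j in A) w j); last first.
    rewrite -expR_sum big_split/= sumrN -mulr_sumr -natr_sum; congr (expR (_ + _)).
    rewrite -big_mkcondr sumr_const -[RHS]mulr_natr; congr (v * _%:R).
    by apply: eq_card => j; rewrite !inE.
  over.
rewrite sum_over_sets expRD /log_gen expR_sum.
have -> : \sum_(i <= j < n) occupation t j.+1%:R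
    = \sum_(j < n) if (i <= j)%N then occupation t j.+1%:R else 0.
  by rewrite -big_mkcond/= big_geq_mkord; apply: eq_bigl => j.
rewrite mulr_sumr expR_sum -big_split/=; apply: ler_prod => j _.
have a0 := expR_gt0 (- (t * j.+1%:R)).
have a1 : 0 < 1 + expR (- (t * j.+1%:R)) by rewrite addr_gt0.
apply/andP; split; first by rewrite addr_ge0// ltW// expR_gt0.
rewrite lnK ?posrE// /w expRD; case: ifP => _; last by rewrite expR0 mulr0 !mulr1 expR0 mulr1.
have -> : 1 + expR (- (t * j.+1%:R)) * expR v = (1 + expR (- (t * j.+1%:R))) *
    (1 + (expR v - 1) * occupation t j.+1%:R).
  by rewrite /occupation; move: (expR _) a1 => a a1; field; rewrite gt_eqF.
by rewrite ler_pM2l//; exact: expR_ge1Dx.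
Qed.

Lemma untilted_sum {R : realType} n (t : R) :
  \sum_(A : {set 'I_n}) expR (- (t * (parts_sum A)%:R)) = expR (log_gen t n).
Proof.
under eq_bigr => A _.
  rewrite (_ : expR _ = \prod_(j in A) expR (- (t * j.+1%:R))); last first.
    by rewrite -expR_sum sumrN -mulr_sumr -natr_sum.
  over.
rewrite sum_over_sets /log_gen expR_sum; apply: eq_bigr => j _.
by rewrite lnK// posrE addr_gt0// expR_gt0.
Qed.

Definition pair_sum {n} (p : {set 'I_n} * {set 'I_n}) : nat :=
  (parts_sum p.1 + parts_sum p.2)%N.

Lemma sum_over_pairs {R : comPzRingType} (T : finType) (f g : T -> R) :
  \sum_(p : T * T) f p.1 * g p.2 = (\sum_x f x) * (\sum_x g x).
Proof. by rewrite big_distrlr pair_big. Qed.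

Lemma pair_sum_weight {R : realType} n (t : R) :
  \sum_(p : {set 'I_n} * {set 'I_n}) expR (- (t * (pair_sum p)%:R))
  = expR (2 * log_gen t n).
Proof.
rewrite mulr_natl expRD -!untilted_sum -sum_over_pairs; apply: eq_bigr => p _.
by rewrite -expRD natrD mulrDr opprD.
Qed.

Lemma card_le_sum {R : numDomainType} (T : finType) (P : pred T) (w : T -> R) :
  (forall x, 0 <= w x) -> (forall x, P x -> 1 <= w x) ->
  #|[set x | P x]%SET|%:R <= \sum_x w x.
Proof.
move=> w0 w1; rewrite -sum1_card natr_sum [leLHS]big_mkcond/=.
by apply: ler_sum => x _; rewrite inE; case: ifP => // /w1.
Qed.

(** Markov's inequality for the tilted weight.  The factor [exp (t * n)] compensates
for the weight of a pair of size at most [n]. *)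
Lemma left_deviation_bound {R : realType} n i (t v K : R) : 0 <= t ->
  #|[set p : {set 'I_n} * {set 'I_n} |
      (pair_sum p <= n)%N && (K <= v * (parts_above i p.1)%:R)]%SET|%:R
  <= expR (t * n%:R + 2 * log_gen t n
       + ((expR v - 1) * \sum_(i <= j < n) occupation t j.+1%:R - K)).
Proof.
move=> t0.
pose w (p : {set 'I_n} * {set 'I_n}) : R :=
  expR (t * n%:R - K) * (expR (- (t * (parts_sum p.1)%:R) + v * (parts_above i p.1)%:R)
   * expR (- (t * (parts_sum p.2)%:R))).
apply: (@le_trans _ _ (\sum_p w p)).
  apply: card_le_sum => p; first by rewrite !mulr_ge0 ?expR_ge0.
  move=> /andP[pn Kp]; rewrite /w -!expRD -[leLHS]expR0 ler_expR.
  have : t * (pair_sum p)%:R <= t * n%:R by rewrite ler_wpM2l// ler_nat.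
  rewrite natrD mulrDr; move: Kp; lra.
rewrite -mulr_sumr.
rewrite (sum_over_pairs _ (fun A => expR (- (t * (parts_sum A)%:R) + v * (parts_above i A)%:R))
   (fun A => expR (- (t * (parts_sum A)%:R)))).
rewrite untilted_sum.
have tilted := ler_wpM2r (expR_ge0 (log_gen t n)) (tilted_sum_bound n i t v).
apply: le_trans (ler_wpM2l (expR_ge0 _) tilted) _.
by rewrite -!expRD ler_expR; lra.
Qed.

Lemma right_deviation_bound {R : realType} n i (t v K : R) : 0 <= t ->
  #|[set p : {set 'I_n} * {set 'I_n} |
      (pair_sum p <= n)%N && (K <= v * (parts_above i p.2)%:R)]%SET|%:R
  <= expR (t * n%:R + 2 * log_gen t n
       + ((expR v - 1) * \sum_(i <= j < n) occupation t j.+1%:R - K)).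
Proof.
move=> t0; apply: le_trans (left_deviation_bound n i t v K t0); rewrite ler_nat.
have swapK : involutive (fun p : {set 'I_n} * {set 'I_n} => (p.2, p.1)) by case.
rewrite -(card_imset _ (inv_inj swapK)); apply: subset_leq_card.
apply/fintype.subsetP => _ /imsetP[p + ->]; rewrite !inE /pair_sum/= addnC; exact.
Qed.

(** The pairs of size between [lo] and [hi] have weight at most [exp (- t * lo)], so
their number is at least [exp (t * lo)] times their total weight.  What is lost
outside of the window is estimated by changing the parameter [t] by [s] in either
direction. *)
Lemma window_card_bound {R : realType} n (t s lo hi : R) : 0 <= t -> 0 <= s ->
  expR (t * lo) * (expR (2 * log_gen t n) - expR (2 * log_gen (t - s) n - s * hi)
     - expR (2 * log_gen (t + s) n + s * lo))
  <= #|[set p : {set 'I_n} * {set 'I_n} | (pair_sum p)%:R <= hi]%SET|%:R.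
Proof.
move=> t0 s0; pose T := ({set 'I_n} * {set 'I_n})%type.
pose S (p : T) : R := (pair_sum p)%:R.
pose u (p : T) : R := (lo <= S p <= hi)%R%:R * expR (- (t * S p)).
have key : expR (2 * log_gen t n) - expR (2 * log_gen (t - s) n - s * hi)
     - expR (2 * log_gen (t + s) n + s * lo) <= \sum_p u p.
  rewrite expRD expRN [X in _ - X]expRD -!pair_sum_weight.
  rewrite 2!lerBlDr mulr_suml mulr_suml -!big_split/=; apply: ler_sum => p _.
  rewrite -expRN -!expRD -/(S p) /u.
  have := expR_ge0 (- (t * S p)).
  have := expR_ge0 (- ((t + s) * S p) + s * lo).
  have := expR_ge0 (- ((t - s) * S p) - s * hi).
  case: (leP lo (S p)) => [_|h1]; case: (leP (S p) hi) => [_|h2] /=;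
    rewrite ?mul1r ?mul0r ?add0r.
  - lra.
  - move=> _ + _; suff : expR (- (t * S p)) <= expR (- ((t - s) * S p) - s * hi) by lra.
    by rewrite ler_expR; have := ler_wpM2l s0 (ltW h2); lra.
  - move=> + _ _; suff : expR (- (t * S p)) <= expR (- ((t + s) * S p) + s * lo) by lra.
    by rewrite ler_expR; have := ler_wpM2l s0 (ltW h1); lra.
  - move=> + _ _; suff : expR (- (t * S p)) <= expR (- ((t + s) * S p) + s * lo) by lra.
    by rewrite ler_expR; have := ler_wpM2l s0 (ltW h1); lra.
apply: le_trans (ler_wpM2l (expR_ge0 _) key) _.
rewrite mulr_sumr -sum1_card natr_sum [leRHS]big_mkcond/=; apply: ler_sum => p _.
rewrite inE /u -/(S p); case: (leP lo (S p)) => h1 /=; last first.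
  by rewrite mul0r mulr0; case: ifP.
case: ifP => _; last by rewrite mul0r mulr0.
rewrite mul1r -expRD -[leRHS]expR0 ler_expR.
have := ler_wpM2l t0 h1; lra.
Qed.

(** * Strongly unimodal sequences and pairs of sets of parts *)

Lemma strongly_unimodalP (s : seq nat) : strongly_unimodal s ->
  exists L m Rt, [/\ s = L ++ m :: Rt, all (ltn 0) s,
    sorted ltn (rcons L m) & sorted gtn (m :: Rt)].
Proof.
move=> [s0 [k ks [h1 h2]]]; exists (take k s), (nth 0%N s k), (drop k.+1 s).
by rewrite -(drop_nth 0%N ks) cat_take_drop -(take_nth 0%N ks).
Qed.

Lemma gtn_transitive : transitive gtn.
Proof. by move=> b a c /= ab bc; exact: ltn_trans bc ab. Qed.

Lemma peak_gt_left (L : seq nat) m : sorted ltn (rcons L m) -> all (gtn m) L.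
Proof.
move=> h; have : sorted gtn (m :: rev L) by rewrite -rev_rcons rev_sorted.
by rewrite /= (path_sortedE gtn_transitive) all_rev => /andP[].
Qed.

Lemma peak_gt_right m (Rt : seq nat) : sorted gtn (m :: Rt) ->
  all (gtn m) Rt && sorted gtn Rt.
Proof.
by rewrite /= (path_sortedE gtn_transitive).
Qed.

Lemma leftmost_peak_cat (L : seq nat) m Rt :
  all (gtn m) L -> all (gtn m) Rt -> leftmost_peak (L ++ m :: Rt) = size L.
Proof.
move=> Lm Rm; rewrite /leftmost_peak.
have -> : (\max_(x <- L ++ m :: Rt) x = m)%N.
  apply/eqP; rewrite eqn_leq; apply/andP; split.
    apply/bigmax_leqP_seq => x; rewrite mem_cat inE => /or3P[xL|/eqP->//|xR] _.
      by have := allP Lm x xL => /= /ltnW.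
    by have := allP Rm x xR => /= /ltnW.
  by rewrite big_cat big_cons/= maxnA leq_max leq_max leqnn orbT.
rewrite index_cat ifN ?index_head ?addn0//.
by apply/negP => /(allP Lm) /=; rewrite ltnn.
Qed.

(** The part [j + 1] is represented by the index [j], since parts are positive. *)
Definition part_set n (s : seq nat) : {set 'I_n} := [set j : 'I_n | j.+1 \in s]%SET.

(** Sums and counts of parts are both of this form. *)
Lemma sum_part_set n (s : seq nat) (F : nat -> nat) :
  uniq s -> all (ltn 0) s -> all (leq^~ n) s ->
  (\sum_(j in part_set n s) F j.+1 = \sum_(x <- s) F x)%N.
Proof.
move=> us s0 sn; rewrite -big_enum/=.
rewrite -(big_map (fun j : 'I_n => j.+1) xpredT F); apply: perm_big.
apply: uniq_perm => //.
  by rewrite map_inj_uniq ?enum_uniq// => i j [/val_inj].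
move=> x; apply/mapP/idP => [[j]|xs].
  by rewrite mem_enum inE => ? ->.
have x0 := allP s0 x xs; have xn := allP sn x xs.
have lt_x : (x.-1 < n)%N by move: x0 xn => /=; lia.
exists (Ordinal lt_x); last by rewrite /= prednK.
by rewrite mem_enum inE /= prednK.
Qed.

Lemma parts_sum_part_set n (s : seq nat) :
  uniq s -> all (ltn 0) s -> all (leq^~ n) s -> parts_sum (part_set n s) = sumn s.
Proof. by move=> us s0 sn; rewrite /parts_sum (sum_part_set n s id)// sumnE. Qed.

Lemma parts_above_part_set n i (s : seq nat) :
  uniq s -> all (ltn 0) s -> all (leq^~ n) s ->
  parts_above i (part_set n s) = count (ltn i) s.
Proof.
move=> us s0 sn; have := sum_part_set n s (fun x => (i < x)%N : nat) us s0 sn.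
rewrite -[in RHS]big_mkcond sum1_count => <-.
rewrite /parts_above -sum1_card -big_mkcondr; apply: eq_bigl => j.
by rewrite !inE.
Qed.

Lemma sorted_part_set_inj n (s1 s2 : seq nat) : sorted ltn s1 -> sorted ltn s2 ->
  all (ltn 0) s1 -> all (leq^~ n) s1 -> all (ltn 0) s2 -> all (leq^~ n) s2 ->
  part_set n s1 = part_set n s2 -> s1 = s2.
Proof.
move=> h1 h2 p1 b1 p2 b2 e; apply: (irr_sorted_eq ltn_trans ltnn) => // x.
case: x => [|x].
  by apply/idP/idP => [/(allP p1)|/(allP p2)].
have [xn|nx] := ltnP x n.
  by have /setP/(_ (Ordinal xn)) := e; rewrite !inE.
by apply/idP/idP => [/(allP b1)|/(allP b2)] /=; lia.
Qed.

Lemma all_le_sumn (s : seq nat) : all (leq^~ (sumn s)) s.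
Proof.
apply/allP => x; elim: s => //= y s IHs; rewrite inE => /orP[/eqP->|/IHs].
  exact: leq_addr.
by move=> /= h; apply: leq_trans h _; exact: leq_addl.
Qed.

Definition left_parts (s : seq nat) : seq nat := take (leftmost_peak s) s.
Definition right_parts (s : seq nat) : seq nat := drop (leftmost_peak s).+1 s.

Definition encode n (s : seq nat) : {set 'I_n} * {set 'I_n} :=
  (part_set n (left_parts s), part_set n (right_parts s)).

Lemma strongly_unimodal_split (s : seq nat) : strongly_unimodal s -> exists m,
  [/\ s = left_parts s ++ m :: right_parts s, all (ltn 0) s,
    sorted ltn (rcons (left_parts s) m) & sorted gtn (m :: right_parts s)].
Proof.
move=> /strongly_unimodalP[L [m [Rt [-> s0 hL hR]]]].
have /andP[Rm _] := peak_gt_right _ _ hR.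
exists m; rewrite /left_parts /right_parts (leftmost_peak_cat _ _ _ (peak_gt_left _ _ hL) Rm).
have -> : drop (size L).+1 (L ++ m :: Rt) = Rt.
  by rewrite -cat_rcons drop_size_cat ?size_rcons.
by rewrite take_size_cat.
Qed.

Lemma part_lists_wf n (s : seq nat) : strongly_unimodal_seqs n s ->
  [/\ sorted ltn (left_parts s), uniq (left_parts s),
      all (ltn 0) (left_parts s) & all (leq^~ n) (left_parts s)] /\
  [/\ sorted gtn (right_parts s), uniq (right_parts s),
      all (ltn 0) (right_parts s) & all (leq^~ n) (right_parts s)].
Proof.
move=> [/strongly_unimodal_split[m [sE s0 hL hR]] <-].
have all_parts (a : pred nat) : all a s -> all a (left_parts s) /\ all a (right_parts s).
  by rewrite {1}sE all_cat /= => /and3P[].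
have [pL pR] := all_parts _ s0; have [bL bR] := all_parts _ (all_le_sumn s).
have /andP[_ sR] := peak_gt_right _ _ hR.
have sL : sorted ltn (left_parts s).
  by move: hL; rewrite -cats1 => /cat_sorted2[].
split; split => //; first exact: sorted_uniq ltn_trans ltnn _ sL.
rewrite -rev_uniq; apply: sorted_uniq ltn_trans ltnn _ _.
by rewrite rev_sorted.
Qed.

(** The sets determine the two monotone lists, and the size determines the peak. *)
Lemma encode_inj n (s1 s2 : seq nat) :
  strongly_unimodal_seqs n s1 -> strongly_unimodal_seqs n s2 ->
  encode n s1 = encode n s2 -> s1 = s2.
Proof.
move=> D1 D2 [eL eR].
have [[sL1 _ pL1 bL1] [sR1 _ pR1 bR1]] := part_lists_wf _ _ D1.
have [[sL2 _ pL2 bL2] [sR2 _ pR2 bR2]] := part_lists_wf _ _ D2.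
have EL : left_parts s1 = left_parts s2 by apply: (sorted_part_set_inj n).
have ER : right_parts s1 = right_parts s2.
  apply: (can_inj revK); apply: (sorted_part_set_inj n); rewrite ?rev_sorted ?all_rev//.
  by apply/setP => j; move/setP/(_ j): eR; rewrite !inE !mem_rev.
have [/strongly_unimodal_split[m1 [E1 _ _ _]] S1] := D1.
have [/strongly_unimodal_split[m2 [E2 _ _ _]] S2] := D2.
rewrite E1 E2 EL ER; congr (_ ++ _ :: _).
by move: S1 S2; rewrite E1 E2 EL ER !sumn_cat /= => <- /addnI/addIn ->.
Qed.

Lemma pair_sum_encode_le n (s : seq nat) : strongly_unimodal_seqs n s ->
  (pair_sum (encode n s) <= n)%N.
Proof.
move=> D; have [[_ uL pL bL] [_ uR pR bR]] := part_lists_wf _ _ D.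
rewrite /pair_sum /= !parts_sum_part_set//.
have [/strongly_unimodal_split[m [E _ _ _]] <-] := D.
by rewrite [in leqRHS]E sumn_cat /=; lia.
Qed.

Lemma parts_above_encode n i (s : seq nat) : strongly_unimodal_seqs n s ->
  parts_above i (encode n s).1 = count (ltn i) (left_parts s) /\
  parts_above i (encode n s).2 = count (ltn i) (right_parts s).
Proof.
move=> D; have [[_ uL pL bL] [_ uR pR bR]] := part_lists_wf _ _ D.
by rewrite !parts_above_part_set.
Qed.

Lemma num_seqs_le_card (T : finType) (A : set (seq nat)) (f : seq nat -> T) (P : {set T}) :
  finite_set A -> {in A &, injective f} -> (forall s, A s -> f s \in P) ->
  (num_seqs A <= #|P|)%N.
Proof.
move=> Afin finj fP; rewrite /num_seqs cardE -(size_map f).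
apply: uniq_leq_size.
  rewrite map_inj_in_uniq ?fset_uniq// => x y; rewrite !in_fset_set// => xA yA.
  exact: finj.
by move=> _ /mapP[x xA ->]; rewrite mem_enum fP//; move: xA; rewrite in_fset_set// inE.
Qed.

Lemma card_le_num_seqs (T : finType) (A : set (seq nat)) (f : T -> seq nat) (P : {set T}) :
  finite_set A -> {in P &, injective f} -> (forall x, x \in P -> A (f x)) ->
  (#|P| <= num_seqs A)%N.
Proof.
move=> Afin finj fA; rewrite /num_seqs cardE -(size_map f).
apply: uniq_leq_size.
  rewrite map_inj_in_uniq ?enum_uniq// => x y; rewrite !mem_enum; exact: finj.
by move=> _ /mapP[x xP ->]; rewrite in_fset_set// inE; apply: fA; rewrite -mem_enum.
Qed.

(** The peak absorbs whatever is missing to reach the size [n]. *)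
Definition decode n {M} (p : {set 'I_M} * {set 'I_M}) : seq nat :=
  [seq j.+1 | j : 'I_M <- enum p.1] ++
  (n - pair_sum p)%N :: rev [seq j.+1 | j : 'I_M <- enum p.2].

Lemma sorted_succ_enum M (A : {set 'I_M}) : sorted ltn [seq j.+1 | j : 'I_M <- enum A].
Proof.
have : sorted ltn (map val (enum A)).
  rewrite {1}/(enum A) -enumT; apply: (subseq_sorted ltn_trans (s2 := map val (enum 'I_M))).
    by apply: map_subseq; rewrite enumT; exact: filter_subseq.
  by rewrite val_enum_ord iota_ltn_sorted.
by rewrite !sorted_map.
Qed.

Lemma sumn_succ_enum M (A : {set 'I_M}) : sumn [seq j.+1 | j : 'I_M <- enum A] = parts_sum A.
Proof. by rewrite sumnE big_map big_enum. Qed.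

Lemma decode_strongly_unimodal n M (p : {set 'I_M} * {set 'I_M}) :
  (pair_sum p + M < n)%N ->
  strongly_unimodal_seqs n (decode n p) /\
  leftmost_peak (decode n p) = size [seq j.+1 | j : 'I_M <- enum p.1].
Proof.
move=> pM.
have lt_peak (A : {set 'I_M}) : all (gtn (n - pair_sum p)%N) [seq j.+1 | j : 'I_M <- enum A].
  by apply/allP => _ /mapP[j _ ->] /=; have := ltn_ord j; lia.
have pos (A : {set 'I_M}) : all (ltn 0) [seq j.+1 | j : 'I_M <- enum A].
  by apply/allP => _ /mapP[j _ ->].
have srt (A : {set 'I_M}) : sorted ltn (rcons [seq j.+1 | j : 'I_M <- enum A] (n - pair_sum p)%N).
  rewrite -[rcons _ _]revK rev_sorted rev_rcons /= (path_sortedE gtn_transitive) all_rev lt_peak.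
  by rewrite rev_sorted sorted_succ_enum.
split; last by rewrite leftmost_peak_cat ?all_rev.
split; last first.
  rewrite /decode sumn_cat/= sumn_rev !sumn_succ_enum; move: pM; rewrite /pair_sum; lia.
split.
  rewrite /decode all_cat/= all_rev !pos/= andbT; lia.
exists (size [seq j.+1 | j : 'I_M <- enum p.1]).
  by rewrite /decode size_cat /= addnS ltnS leq_addr.
rewrite /decode drop_size_cat//; split.
  by rewrite -cat_rcons take_size_cat ?size_rcons.
by rewrite -rev_rcons rev_sorted.
Qed.

(** The hypothesis on [p] makes the peak larger than any of the other parts, which
are at most [M]. *)
Lemma decode_card_le n M :
  (#|[set p : {set 'I_M} * {set 'I_M} | (pair_sum p + M < n)%N]%SET|
    <= num_strongly_unimodal n)%N.
Proof.
apply: (card_le_num_seqs _ _ (decode n)).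
- exact: finite_strongly_unimodal_seqs.
- have Sinj : injective (fun j : 'I_M => j.+1) by move=> i j [/val_inj].
  move=> [A B] [A' B']; rewrite !inE => h h' e.
  have [_ k] := decode_strongly_unimodal _ _ _ h.
  have [_ k'] := decode_strongly_unimodal _ _ _ h'.
  rewrite e k' in k; move/eqP: e.
  rewrite /decode eqseq_cat/= ?k// => /andP[/eqP/(inj_map Sinj) eA].
  rewrite eqseq_cons => /andP[_ /eqP/(can_inj revK)/(inj_map Sinj) eB].
  by congr (_, _); apply/setP => j; rewrite -mem_enum -[RHS]mem_enum ?eA ?eB.
- by move=> p; rewrite inE => /decode_strongly_unimodal[].
Qed.

(** * From counts of parts to the shape *)

Lemma sorted_gtn_cons x (X : seq nat) : sorted gtn (x :: X) ->
  (forall y, y \in X -> (y < x)%N) /\ sorted gtn X.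
Proof. by case/peak_gt_right/andP => /allP h ->. Qed.

Lemma sorted_gtn_nth (X : seq nat) d : sorted gtn X ->
  (nth 0 X d.+1 <= nth 0 X d)%N.
Proof.
elim: X d => [|x X IH] d; first by rewrite !nth_nil.
move=> /sorted_gtn_cons[hx /[dup] sX /IH h]; case: d => [|d] /=; last exact: h.
case: X hx {IH h sX} => [|y X] // hx /=; apply/ltnW/hx; exact: mem_head.
Qed.

(** In this lemma and the next ones, the entries of a monotone list on one side of a
position control the number of entries larger than [i].  A position outside of
the list is read as height [0], as in the definition of the vertical steps. *)
Lemma count_above_le (X : seq nat) i d : sorted gtn X ->
  (nth 0 X d <= i)%N -> (count (ltn i) X <= d)%N.
Proof.
elim: X d => [|x X IH] d // /sorted_gtn_cons[hx sX]; case: d => [|d] /= h.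
  rewrite ltnNge h /= leqNgt -has_count; apply/hasPn => y /hx /= ?; lia.
by rewrite -[d.+1]add1n leq_add ?leq_b1//; exact: IH.
Qed.

Lemma count_above_ge (X : seq nat) i d : sorted gtn X -> (d <= size X)%N ->
  ((0 < d)%N -> (i < nth 0 (0%N :: X) d)%N) -> (d <= count (ltn i) X)%N.
Proof.
elim: X d => [|x X IH] d; first by rewrite leqn0 => _ /eqP->.
move=> /sorted_gtn_cons[hx sX]; case: d => [|d] //= dX /(_ isT) h.
have ix : (i < x)%N.
  case: d dX h => [|d] //= dX h; apply: (ltn_trans h); apply: hx; exact: mem_nth.
rewrite ix add1n ltnS; apply: IH => // d0.
by case: d d0 dX h.
Qed.

Lemma count_above_increasing_le (X : seq nat) i j : sorted ltn X -> (j <= size X)%N ->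
  (nth 0 (0%N :: X) j <= i)%N -> (count (ltn i) X <= size X - j)%N.
Proof.
move=> sX jX h; rewrite -count_rev; apply: count_above_le; first by rewrite rev_sorted.
case: j jX h => [|j] jX h; first by rewrite subn0 nth_default ?size_rev.
by rewrite nth_rev; [rewrite (_ : _ - _ = j)%N//|]; lia.
Qed.

Lemma count_above_increasing_ge (X : seq nat) i j : sorted ltn X -> (j <= size X)%N ->
  ((j < size X)%N -> (i < nth 0 X j)%N) -> (size X - j <= count (ltn i) X)%N.
Proof.
move=> sX jX h; rewrite -count_rev; apply: count_above_ge.
- by rewrite rev_sorted.
- by rewrite size_rev leq_subr.
rewrite subn_gt0 => jX'; move: (h jX').
rewrite (_ : size X - j = (size X - j.+1).+1)%N/=; last lia.
by rewrite nth_rev; [rewrite (_ : size X - _ = j)%N//|]; lia.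
Qed.

Lemma nth_sumn_le (s : seq nat) j : (nth 0 s j <= sumn s)%N.
Proof.
have [js|js] := ltnP j (size s); last by rewrite nth_default.
exact: (allP (all_le_sumn s)) _ (mem_nth _ js).
Qed.

(** On the left side the columns of height larger than a given one are the last ones
before the [y]-axis, on the right side they are the first ones after the peak.
So their number is the distance of the border to the axis, up to the width of the
peak column, which lies on the right of the axis. *)
Lemma shape_counts {R : realType} (s : seq nat) (p : R * R) :
  strongly_unimodal s -> @Defs.shape R s p ->
  0 <= p.2 <= (sumn s)%:R /\
  exists2 X : seq nat,
    (X = left_parts s /\ p.1 <= 0) \/ (X = right_parts s /\ 0 <= p.1) &
    (forall i : nat, (p.2 < i.+1%:R -> (count (ltn i) X)%:R <= `|p.1|) /\
                     (i%:R < p.2 -> `|p.1| <= (count (ltn i) X)%:R + 1)).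
Proof.
move=> su; have [m [sE s0 hL hR]] := strongly_unimodal_split _ su.
set L := left_parts s in sE hL *; set Rt := right_parts s in sE hR *.
set k := leftmost_peak s.
have kE : k = size L.
  have /andP[Rm _] := peak_gt_right _ _ hR.
  by rewrite /k sE leftmost_peak_cat// peak_gt_left.
have sL : sorted ltn L by move: hL; rewrite -cats1 => /cat_sorted2[].
have [_ sR] := sorted_gtn_cons _ _ hR.
have nthL j : (j < k)%N -> nth 0%N s j = nth 0%N L j.
  by rewrite kE => jk; rewrite sE nth_cat jk.
have nthR d : nth 0%N s (k + d) = nth 0%N (m :: Rt) d.
  by rewrite sE nth_cat kE ltnNge leq_addr /= addKn.
have sizeE : size s = (k + size Rt).+1 by rewrite sE size_cat /= kE addnS.
have absB (a b : nat) : (a <= b)%N -> `|a%:R - b%:R : R| = (b - a)%:R.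
  by move=> ab; rewrite distrC -natrB// normr_nat.
case=> [[j /= js [/andP[x1 x2] yE]]|[j /= js [xE /andP[y1 y2]]]].
- rewrite yE; split; first by rewrite ler0n ler_nat nth_sumn_le.
  have [jk|kj] := ltnP j k.
    exists L; first by left; split => //; apply: le_trans x2 _; rewrite subr_le0 ler_nat.
    have xL : k%:R - j.+1%:R <= `|p.1| <= k%:R - j%:R.
      rewrite ler0_norm; last by apply: le_trans x2 _; rewrite subr_le0 ler_nat.
      by move: x1 x2; rewrite /column_edge -/k; lra.
    move: xL => /andP[xL1 xL2] i; rewrite ltr_nat ltr_nat nthL//; split => h.
      apply: le_trans xL1; rewrite -natrB// ler_nat kE.
      by apply: count_above_increasing_le => //; rewrite -kE.
    apply: le_trans xL2 _; rewrite -natrB ?(ltnW jk)// natr1 ler_nat.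
    rewrite kE; apply: leqW; apply: count_above_increasing_ge => //.
    by rewrite -kE ltnW.
  (* The peak column is [d = 0]; it is not among the right parts, so the column [d]
     is the right part of index [d - 1]. *)
have [d jE] : exists d, j = (k + d)%N by exists (j - k)%N; rewrite subnKC.
  have x0 : d%:R <= p.1 <= d%:R + 1.
    by move: x1 x2; rewrite /column_edge -/k jE -addnS !natrD -natr1; lra.
  have p0 : 0 <= p.1 by case/andP: x0 => + _; apply: le_trans; rewrite ler0n.
  exists Rt; first by right.
  move: x0 => /andP[x01 x02] i; rewrite ger0_norm// jE nthR !ltr_nat; split => h.
    apply: le_trans x01; rewrite ler_nat; apply: count_above_le => //.
    by have := sorted_gtn_nth _ d hR; move: h => /=; lia.
  apply: le_trans x02 _; rewrite lerD2r ler_nat; apply: count_above_ge => //.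
    by move: js; rewrite jE sizeE; lia.
  by case: (d) h.
- set a := nth 0%N (0%N :: s) j in y1 y2; set b := nth 0%N s j in y1 y2.
  have an : (a <= sumn s)%N by rewrite /a; case: (j) => [|j']//=; exact: nth_sumn_le.
  split.
    rewrite (le_trans _ y1) ?ler0n//= (le_trans y2)// ler_nat geq_max an.
    exact: nth_sumn_le.
  have [jk|kj] := leqP j k.
    have ab : (a <= b)%N.
      rewrite /a /b; case: (j) jk => [|j'] //= jk.
      have sz : size (rcons L m) = k.+1 by rewrite size_rcons kE.
      have e j0 : (j0 <= k)%N -> nth 0%N s j0 = nth 0%N (rcons L m) j0.
        by rewrite sE -cat_rcons nth_cat sz ltnS => ->.
      rewrite !e ?(ltnW jk)//; apply/ltnW.
      by apply: (sorted_ltn_nth ltn_trans _ hL); rewrite ?inE ?sz ?ltnS// ltnW.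
    exists L; first by left; split => //; rewrite xE subr_le0 ler_nat.
    move=> i; rewrite xE /column_edge -/k absB//; split => h.
      have ai : (a <= i)%N by move: (le_lt_trans y1 h); rewrite ltr_nat (minn_idPl ab) ltnS.
      rewrite ler_nat kE; apply: count_above_increasing_le; rewrite -?kE//.
      move: ai; rewrite /a; case: (j) jk => [|j']//= jk; by rewrite nthL.
    have ib : (i < b)%N by move: (lt_le_trans h y2); rewrite ltr_nat (maxn_idPr ab).
    rewrite natr1 ler_nat kE; apply: leqW.
    apply: count_above_increasing_ge; rewrite -?kE// => jk'.
    by rewrite -nthL.
  (* To the right of the peak: the step is between the entries [d] and [d + 1] of
     [m :: Rt]. *)
have [d jE] : exists d, j = (k + d.+1)%N by exists (j - k.+1)%N; lia.
  have aE : a = nth 0%N (m :: Rt) d by rewrite /a jE addnS /= nthR.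
  have bE : b = nth 0%N Rt d by rewrite /b jE nthR.
  have ba : (b <= a)%N by rewrite aE bE; exact: (sorted_gtn_nth _ d hR).
  have xE' : p.1 = d.+1%:R by rewrite xE /column_edge -/k jE natrD addrAC subrr add0r.
  exists Rt; first by right; rewrite xE' ler0n.
  move=> i; rewrite xE' normr_nat; split => h.
    have bi : (b <= i)%N by move: (le_lt_trans y1 h); rewrite ltr_nat (minn_idPr ba) ltnS.
    by rewrite ler_nat; apply: leqW; apply: count_above_le => //; rewrite -bE.
  have ia : (i < a)%N by move: (lt_le_trans h y2); rewrite ltr_nat (maxn_idPl ba).
  rewrite -natr1 lerD2r ler_nat; apply: count_above_ge => //.
    by move: js; rewrite jE sizeE; lia.
  by move: ia; rewrite aE; case: (d).
Qed.

(** For [t = pi / sqrt 6] the equations [x = profile t y] and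
[exp (- t * y) = exp (t * x) - 1] are equivalent. *)
Lemma f_d_profile {R : realType} (y : R) : 0 <= y ->
  let x := ln (1 + expR (- (pi / Num.sqrt 6 * y))) / (pi / Num.sqrt 6) in
  [/\ @f_d_dom R x, @f_d_dom R (- x), f_d x = y & f_d (- x) = y].
Proof.
move=> y0 x; have c0 : 0 < pi / Num.sqrt 6 :> R by rewrite divr_gt0 ?pi_gt0// sqrtr_gt0.
have cV : Num.sqrt 6 / pi = (pi / Num.sqrt 6 : R)^-1 by rewrite invf_div.
have cx : pi / Num.sqrt 6 * x = ln (1 + expR (- (pi / Num.sqrt 6 * y))).
  by rewrite mulrC divfK ?gt_eqF.
have x0 : 0 < x by rewrite divr_gt0// ln_gt0// ltrDl expR_gt0.
have xle : x <= Num.sqrt 6 / pi * ln 2.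
  rewrite cV [leRHS]mulrC ler_pM2r ?invr_gt0// ler_ln ?posrE ?addr_gt0 ?expR_gt0//.
  have -> : 2 = 1 + 1 :> R by [].
  by rewrite lerD2l expR_le1 oppr_le0 mulr_ge0 ?(ltW c0).
have val : - (Num.sqrt 6 / pi) * ln (expR (pi / Num.sqrt 6 * x) - 1) = y.
  rewrite cx lnK ?posrE ?addr_gt0 ?expR_gt0// addrAC subrr add0r expRK cV.
  by rewrite mulrN mulNr opprK mulKf ?gt_eqF.
split.
- by right; rewrite /= in_itv/= x0.
- by left; rewrite /= in_itv/= lerN2 xle oppr_lt0.
- by rewrite /f_d ltNge ltW.
- by rewrite /f_d oppr_lt0 x0 mulrNN.
Qed.

(** The integers [i] next to the height [y] give [count (ltn i) <= `|x|] and
[`|x| <= count (ltn i) + 1]; the profile changes by at most [1] between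
consecutive integers. *)
Lemma shape_in_nbhd {R : realType} (n : nat) (eps rho : R) (s : seq nat) :
  (0 < n)%N -> 0 < eps -> rho * Num.sqrt n%:R + 1 <= eps * Num.sqrt n%:R ->
  strongly_unimodal_seqs n s ->
  (forall i X, (i <= n)%N -> X = left_parts s \/ X = right_parts s ->
    `|(count (ltn i) X)%:R - profile (pi / Num.sqrt 6 / Num.sqrt n%:R) i.+1%:R|
      <= rho * Num.sqrt n%:R) ->
  @renormalized_shape R s `<=` curve_nbhd eps (@f_d_dom R) (@f_d R).
Proof.
move=> n0 eps0 rho_eps [su sn] close _ [p /(shape_counts s p su)[py [X hX hp]] <-].
rewrite sn in py *; set r := Num.sqrt n%:R in rho_eps close *.
have r0 : 0 < r by rewrite sqrtr_gt0 ltr0n.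
set t := pi / Num.sqrt 6 / r in close.
have t0 : 0 < t by rewrite !divr_gt0 ?pi_gt0// sqrtr_gt0.
have [yle|ygt] := lerP p.2 (eps * r).
  left; right => /=; case/andP: py => py _.
  by rewrite ger0_norm ?divr_ge0 ?(ltW r0)// ler_pdivrMr.
have y0 : 0 < p.2 by apply: lt_trans ygt; rewrite mulr_gt0.
have XE : X = left_parts s \/ X = right_parts s by case: hX => -[-> _]; [left|right].
have lo : profile t p.2 <= `|p.1| + (rho * r + 1).
  have /truncn_itv/andP[i1 i2] := ltW y0; set i := Num.truncn p.2 in i1 i2.
  have le_in : (i <= n)%N by rewrite -(ler_nat R); case/andP: py => _; exact: le_trans.
  have [h _] := hp i; have := h i2; have := close i X le_in XE.
  have := le_profile t _ _ t0 i1; have /andP[+ _] := profile_step t i%:R t0.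
  have /andP[_ f1] := occupation_itv t i%:R.
  by rewrite natr1 ler_norml => a1 a2 /andP[a3 a4] a5; move: f1; lra.
have hi : `|p.1| <= profile t p.2 + (rho * r + 1).
  have [i [i1 i2]] : exists i : nat, i%:R < p.2 /\ p.2 <= i.+1%:R.
    have /truncn_itv/andP[i1 i2] := ltW y0; move: i1 i2.
    case: (Num.truncn p.2) => [|i] i1 i2; first by exists 0%N; rewrite y0 ltW.
    move: i1; rewrite le_eqVlt => /orP[/eqP e|i1]; last by exists i.+1; rewrite i1 ltW.
    by exists i; rewrite -e ltr_nat.
  have le_in : (i <= n)%N.
    by rewrite -(ler_nat R); case/andP: py => _; apply: le_trans; exact: ltW.
  have [_ h] := hp i; have := h i1; have := close i X le_in XE.
  have := le_profile t _ _ t0 i2.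
  by rewrite ler_norml => a2 /andP[a3 a4] a5; lra.
have y'0 : 0 <= p.2 / r by rewrite divr_ge0 ?ltW.
have [dom1 dom2 val1 val2] := f_d_profile _ y'0.
set x := ln _ / _ in dom1 dom2 val1 val2.
have xE : x = profile t p.2 / r.
  rewrite /x /profile /t; have -> : pi / Num.sqrt 6 * (p.2 / r) = pi / Num.sqrt 6 / r * p.2.
    by rewrite mulrA mulrAC.
  by rewrite -[RHS]mulrA -invfM divfK ?gt_eqF.
have near : `| profile t p.2 - `|p.1| | <= eps * r.
  rewrite ler_norml; move: lo hi rho_eps; lra.
left; left; case: hX => -[_ p10].
  exists (- x) => //; split => //=; rewrite xE.
  have -> : - (profile t p.2 / r) - p.1 / r = - ((profile t p.2 - `|p.1|) / r).
    by rewrite ler0_norm//; ring.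
  by rewrite normrN normf_div (gtr0_norm r0) ler_pdivrMr.
exists x => //; split => //=; rewrite xE.
have -> : profile t p.2 / r - p.1 / r = (profile t p.2 - `|p.1|) / r.
  by rewrite ger0_norm//; ring.
by rewrite normf_div (gtr0_norm r0) ler_pdivrMr.
Qed.

(** * The saddle point and the lower bound for the number of sequences *)

(** The limit curve approaches the [y]-axis like [exp (- curve_rate * y)]. *)
Definition curve_rate (R : realType) : R := pi / Num.sqrt 6.

(** This is the parameter for the size [n + 1]; the shift makes it positive for all
[n]. *)
Definition saddle {R : realType} (n : nat) : R := curve_rate R / Num.sqrt n.+1%:R.

Lemma curve_rate_gt0 {R : realType} : 0 < curve_rate R.
Proof. by rewrite divr_gt0 ?pi_gt0// sqrtr_gt0. Qed.

Lemma curve_rate_sqr {R : realType} : curve_rate R ^+ 2 = pi ^+ 2 / 6.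
Proof. by rewrite expr_div_n sqr_sqrtr. Qed.

Lemma curve_rate_bounds {R : realType} : 2^-1 <= curve_rate R <= 2.
Proof.
have s2 : 2 <= Num.sqrt 6 :> R.
  rewrite -[leLHS]ger0_norm// -sqrtr_sqr ler_wsqrtr// -natrX ler_nat//.
have s4 : Num.sqrt 6 <= 4 :> R.
  rewrite -[leRHS]ger0_norm// -sqrtr_sqr ler_wsqrtr// -natrX ler_nat//.
have s0 : 0 < Num.sqrt 6 :> R by rewrite sqrtr_gt0.
have p2 := pi_ge2 R; have p4 : pi < 4 :> R by have := pihalf_lt2 R; lra.
rewrite /curve_rate ler_pdivlMr// ler_pdivrMr//; apply/andP; split; lra.
Qed.

Lemma sqrtS_gt0 {R : realType} n : 0 < Num.sqrt n.+1%:R :> R.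
Proof. by rewrite sqrtr_gt0 ltr0n. Qed.

Lemma saddle_gt0 {R : realType} n : 0 < saddle n :> R.
Proof. by rewrite divr_gt0 ?curve_rate_gt0 ?sqrtS_gt0. Qed.

Lemma saddle_mul_size {R : realType} n : saddle n * n.+1%:R = curve_rate R * Num.sqrt n.+1%:R.
Proof.
rewrite /saddle -[in X in _ * X](@sqr_sqrtr R n.+1%:R)//.
by rewrite expr2 mulrA divfK// gt_eqF// sqrtS_gt0.
Qed.

Lemma sqrtS_cvg {R : realType} : (Num.sqrt n.+1%:R : R) @[n --> \oo] --> +oo.
Proof.
apply/cvgryPge => A; near=> n.
have h : A ^+ 2 <= n.+1%:R.
  by apply: (@le_trans _ _ n%:R); rewrite ?ler_nat//; near: n; exact: nbhs_infty_ger.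
apply: le_trans (ler_norm A) _; rewrite -sqrtr_sqr; exact: ler_wsqrtr.
Unshelve. all: end_near. Qed.

Lemma saddle_cvg {R : realType} : (saddle n : R) @[n --> \oo] --> 0.
Proof.
rewrite -[X in _ --> X](mulr0 (curve_rate R)); apply: cvgMr.
apply/(gtr0_cvgV0 (f := fun n => Num.sqrt n.+1%:R)); last exact: sqrtS_cvg.
by near=> n; exact: sqrtS_gt0.
Unshelve. all: end_near. Qed.

(** With [x = curve_rate * sqrt (n + 1)] both [saddle n * (n + 1)] and
[curve_rate ^ 2 / saddle n] are equal to [x], and all exponents below are
multiples of [x]. *)
Lemma log_gen_near {R : realType} (lam kap : R) (M : nat -> nat) :
  0 < lam -> 0 < kap ->
  saddle n * (M n)%:R @[n --> \oo] --> (+oo : set_system R) ->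
  \forall n \near \oo,
    (1 - kap) * (curve_rate R * Num.sqrt n.+1%:R) / lam <= 2 * log_gen (lam * saddle n) (M n)
    <= (1 + kap) * (curve_rate R * Num.sqrt n.+1%:R) / lam.
Proof.
move=> lam0 kap0 tM.
have lt0 n : 0 < lam * saddle n by rewrite mulr_gt0// saddle_gt0.
have lcvg : lam * saddle n @[n --> \oo] --> 0.
  by rewrite -[X in _ --> X](mulr0 lam); apply: cvgMr; exact: saddle_cvg.
have lM : lam * saddle n * (M n)%:R @[n --> \oo] --> +oo.
  apply/cvgryPge => A; have /cvgryPge/(_ (A / lam)) := tM.
  by apply: filterS => n; rewrite ler_pdivrMr// mulrC mulrA.
have k0 : 0 < kap * (pi ^+ 2 / 12).
  by rewrite mulr_gt0// divr_gt0// exprn_gt0// pi_gt0.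
have /cvgrPdistC_le/(_ _ k0)[] := log_gen_cvg _ M lt0 lcvg lM.
move=> n0 _ h; exists n0 => // n /h /=.
have -> : pi ^+ 2 / 12 = curve_rate R ^+ 2 / 2 by rewrite curve_rate_sqr; lra.
set c := curve_rate R; have c0 : 0 < c := curve_rate_gt0.
set r := Num.sqrt n.+1%:R; have r0 : 0 < r := sqrtS_gt0 n.
rewrite ler_norml => /andP[h1 h2].
set G := log_gen _ _ in h1 h2 *.
have tE : c * r * saddle n = c ^+ 2 by rewrite /saddle -/c -/r; field; rewrite gt_eqF.
have t0 := lt0 n.
have e k : k * (c * r) / lam * (lam * saddle n) = k * c ^+ 2.
  by rewrite mulrA divfK ?gt_eqF// -mulrA tE.
apply/andP; split; rewrite -(ler_pM2r t0) e; lra.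
Qed.

(** To first order, [A], [B] and [C] are the values of [x / lam] for [lam] equal to
[1 + dl], [1] and [1 + 2 * dl].  To second order in [dl], the exponents of the two
terms that are subtracted are [1 - dl + dl ^ 2 / 4] and [1 - dl] times [x], against
[1 - dl + dl ^ 2] for [A]; the relative error [dl ^ 2 / 16] allowed in the
asymptotics is small enough not to spoil this. *)
Lemma window_estimate {R : realType} (x dl A B C : R) :
  0 < dl <= 4^-1 -> 1 <= dl * x -> expR (- (dl ^+ 2 / 8 * x)) <= 4^-1 ->
  (1 - dl ^+ 2 / 16) * x / (1 + dl) <= A ->
  B <= (1 + dl ^+ 2 / 16) * x ->
  C <= (1 + dl ^+ 2 / 16) * x / (1 + 2 * dl) ->
  expR ((2 - 10 * dl) * x) <=
  expR ((1 + dl) * (1 - 4 * dl) * x) *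
    (expR A - expR (B - dl * (1 - dl / 4) * x) - expR (C + dl * (1 - 4 * dl) * x)).
Proof.
move=> /andP[d0 d4] dx e4 hA hB hC.
have x0 : 0 < x by rewrite -(pmulr_rgt0 x d0); lra.
have u1 : 1 - dl + dl ^+ 2 / 2 <= (1 + dl)^-1.
  rewrite -[leRHS]mul1r ler_pdivlMr; last lra.
  have := exprn_gt0 2 d0; have : 0 <= dl ^+ 2 * (1 - dl) by rewrite mulr_ge0 ?sqr_ge0//; lra.
  lra.
have u1' : (1 + dl)^-1 <= 1.
  by rewrite invf_le1; lra.
have u2 : (1 + 2 * dl)^-1 <= (1 + dl)^-1 - dl + 3 * dl ^+ 2.
  have p1 : 0 < 1 + dl by lra.
  have p2 : 0 < 1 + 2 * dl by lra.
  rewrite -subr_ge0; have -> : (1 + dl)^-1 - dl + 3 * dl ^+ 2 - (1 + 2 * dl)^-1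
      = dl ^+ 2 * (7 * dl + 6 * dl ^+ 2) / ((1 + dl) * (1 + 2 * dl)).
    by field; rewrite !gt_eqF.
  rewrite divr_ge0// mulr_ge0 ?sqr_ge0 ?(ltW p1) ?(ltW p2)//.
  by have := sqr_ge0 dl; lra.
have u2' : (1 + 2 * dl)^-1 <= 1 by rewrite invf_le1; lra.
have d2 : 0 <= dl ^+ 2 by exact: sqr_ge0.
set k := dl ^+ 2 / 16 in hA hB hC; have k0 : 0 <= k by rewrite divr_ge0.
have kE : dl ^+ 2 = 16 * k by rewrite /k; lra.
pose a1 := (1 + dl)^-1; pose a2 := (1 + 2 * dl)^-1.
have hA' : (a1 - k) * x <= A.
  apply: le_trans hA; rewrite mulrAC ler_pM2r//.
  have := ler_wpM2l k0 u1'; rewrite -/a1; lra.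
have hC' : C <= (a2 + k) * x.
  apply: le_trans hC _; rewrite mulrAC ler_pM2r//.
  have := ler_wpM2l k0 u2'; rewrite -/a2; lra.
have E1 : expR (B - dl * (1 - dl / 4) * x) <= expR A * 4^-1.
  apply: le_trans (ler_wpM2l (expR_ge0 A) e4); rewrite -expRD ler_expR.
  have : (1 + k - dl * (1 - dl / 4) + dl ^+ 2 / 8) * x <= (a1 - k) * x.
    by rewrite ler_pM2r// /a1; move: u1; lra.
  lra.
have E2 : expR (C + dl * (1 - 4 * dl) * x) <= expR A * 4^-1.
  apply: le_trans (ler_wpM2l (expR_ge0 A) e4); rewrite -expRD ler_expR.
  have : (a2 + k + dl * (1 - 4 * dl) + dl ^+ 2 / 8) * x <= (a1 - k) * x.
    by rewrite ler_pM2r// /a1 /a2; move: u2; lra.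
  lra.
have e2 : expR (- 1) <= 2^-1 :> R.
  rewrite expRN lef_pV2 ?posrE ?expR_gt0//.
  by have := @expR_ge1Dx R 1; lra.
apply: (@le_trans _ _ (expR ((1 + dl) * (1 - 4 * dl) * x) * (expR A * expR (- 1)))); last first.
  rewrite ler_pM2l ?expR_gt0//.
  by have := ler_wpM2l (expR_ge0 A) e2; lra.
rewrite -!expRD ler_expR.
have : (2 - 9 * dl) * x <= ((1 + dl) * (1 - 4 * dl) + (a1 - k)) * x.
  rewrite ler_pM2r// /a1.
  have : 0 <= dl * (1 - 4 * dl) by rewrite mulr_ge0; lra.
  move: u1; lra.
lra.
Qed.

(** The typical size of a pair for the parameter [(1 + dl) * saddle n] is
[(n + 1) / (1 + dl) ^ 2], inside the window from [(1 - 4 * dl) * (n + 1)] to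
[(1 - dl / 4) * (n + 1)].  The parts are bounded by [dl / 8 * (n + 1)], which
leaves room for the peak and is still much larger than the order [sqrt n] of the
typical parts, so that the asymptotics of [log_gen] apply. *)
Lemma num_strongly_unimodal_lower {R : realType} (dl : R) : 0 < dl <= 4^-1 ->
  \forall n \near \oo,
    expR ((2 - 10 * dl) * (curve_rate R * Num.sqrt n.+1%:R))
      <= (num_strongly_unimodal n.+1)%:R.
Proof.
move=> /[dup] dlP /andP[d0 d4].
(* Largest part allowed on either side of the peak. *)
pose M n := Num.truncn (dl / 8 * n.+1%:R).
have Mle n : (M n)%:R <= dl / 8 * n.+1%:R by rewrite truncn_le mulr_ge0 ?divr_ge0 ?ltW.
have tM : saddle n * (M n)%:R @[n --> \oo] --> (+oo : set_system R).
  apply/cvgryPge => A; have /cvgryPge/(_ ((A + 2) * 16 / dl)) := @sqrtS_cvg R.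
  apply: filterS => n h.
  have /andP[c1 c2] := @curve_rate_bounds R.
  have r0 := @sqrtS_gt0 R n.
  have t0 := @saddle_gt0 R n.
  have t2 : saddle n <= 2 :> R.
    rewrite /saddle ler_pdivrMr//; apply: le_trans c2 _.
    by rewrite ler_peMr// -[leLHS]sqrtr1 ler_wsqrtr// ler1n.
  have : saddle n * (dl / 8 * n.+1%:R) <= saddle n * ((M n)%:R + 1).
    by rewrite ler_pM2l// natr1 ltW// truncnS_gt.
  rewrite mulrCA saddle_mul_size mulrDr mulr1.
  have : dl / 8 * (2^-1 * Num.sqrt n.+1%:R) <= dl / 8 * (curve_rate R * Num.sqrt n.+1%:R).
    by rewrite ler_pM2l ?divr_gt0// ler_pM2r.
  move: h; rewrite ler_pdivrMr//; lra.
have k0 : 0 < dl ^+ 2 / 16 by rewrite divr_gt0// exprn_gt0.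
have nA := log_gen_near (1 + dl) _ M ltac:(lra) k0 tM.
have nB := log_gen_near 1 _ M ltac:(lra) k0 tM.
have nC := log_gen_near (1 + 2 * dl) _ M ltac:(lra) k0 tM.
have /cvgryPge n1 := @sqrtS_cvg R.
near=> n.
have /andP[hA _] : (1 - dl ^+ 2 / 16) * (curve_rate R * Num.sqrt n.+1%:R) / (1 + dl) <=
    2 * log_gen ((1 + dl) * saddle n) (M n) <=
    (1 + dl ^+ 2 / 16) * (curve_rate R * Num.sqrt n.+1%:R) / (1 + dl) by near: n.
have /andP[_ hB] : (1 - dl ^+ 2 / 16) * (curve_rate R * Num.sqrt n.+1%:R) / 1 <=
    2 * log_gen (1 * saddle n) (M n) <=
    (1 + dl ^+ 2 / 16) * (curve_rate R * Num.sqrt n.+1%:R) / 1 by near: n.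
have /andP[_ hC] : (1 - dl ^+ 2 / 16) * (curve_rate R * Num.sqrt n.+1%:R) / (1 + 2 * dl) <=
    2 * log_gen ((1 + 2 * dl) * saddle n) (M n) <=
    (1 + dl ^+ 2 / 16) * (curve_rate R * Num.sqrt n.+1%:R) / (1 + 2 * dl) by near: n.
set x := curve_rate R * Num.sqrt n.+1%:R.
have xge : Num.sqrt n.+1%:R / 2 <= x.
  by rewrite mulrC ler_pM2r ?sqrtS_gt0//; case/andP: (@curve_rate_bounds R).
have xA y : 2 * y <= Num.sqrt n.+1%:R -> y <= x by lra.
have dx : 1 <= dl * x.
  rewrite mulrC -ler_pdivrMr//; apply: xA; near: n; exact: n1.
have e4 : expR (- (dl ^+ 2 / 8 * x)) <= 4^-1.
  rewrite expRN lef_pV2 ?posrE ?expR_gt0//.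
  apply: le_trans (expR_ge1Dx _).
  suff : 3 / (dl ^+ 2 / 8) <= x.
    by rewrite ler_pdivrMr ?divr_gt0 ?exprn_gt0//; lra.
  apply: xA; near: n; exact: n1.
rewrite divr1 in hB; rewrite -/x in hA hB hC.
apply: le_trans (window_estimate _ _ _ _ _ dlP dx e4 hA hB hC) _.
have t0 := @saddle_gt0 R n.
have := window_card_bound (M n) ((1 + dl) * saddle n) (dl * saddle n)
  ((1 - 4 * dl) * n.+1%:R) ((1 - dl / 4) * n.+1%:R).
have -> : (1 + dl) * saddle n - dl * saddle n = 1 * saddle n by ring.
have -> : (1 + dl) * saddle n + dl * saddle n = (1 + 2 * dl) * saddle n by ring.
have tx : saddle n * n.+1%:R = x := saddle_mul_size n.
have -> : (1 + dl) * saddle n * ((1 - 4 * dl) * n.+1%:R) = (1 + dl) * (1 - 4 * dl) * x.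
  by rewrite -tx; ring.
have -> : dl * saddle n * ((1 - 4 * dl) * n.+1%:R) = dl * (1 - 4 * dl) * x.
  by rewrite -tx; ring.
have -> : dl * saddle n * ((1 - dl / 4) * n.+1%:R) = dl * (1 - dl / 4) * x.
  by rewrite -tx; ring.
move=> /(_ ltac:(rewrite mulr_ge0 ?(ltW t0)//; lra) ltac:(rewrite mulr_ge0 ?(ltW t0)//; lra)).
move/le_trans; apply; rewrite ler_nat; apply: leq_trans (decode_card_le n.+1 (M n)).
apply: subset_leq_card; apply/fintype.subsetP => p; rewrite !inE => hp.
rewrite -(ltr_nat R) natrD.
have := Mle n; have : 0 < dl / 8 * n.+1%:R by rewrite mulr_gt0 ?divr_gt0// ltr0n.
lra.
Unshelve. all: end_near. Qed.

(** * Few pairs deviate from the profile *)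

Lemma expR_le_quadratic {R : realType} (v : R) : `|v| <= 2^-1 ->
  expR v <= 1 + v + 2 * v ^+ 2.
Proof.
rewrite ler_norml => /andP[v1 v2].
have p : 0 < 1 - v by lra.
have h : expR v <= (1 - v)^-1.
  by rewrite -[v in leLHS]opprK expRN lef_pV2 ?posrE ?expR_gt0//; exact: expR_ge1Dx.
apply: le_trans h _; rewrite -[leLHS]mul1r ler_pdivrMr//.
have : 0 <= v ^+ 2 * (1 - 2 * v) by rewrite mulr_ge0 ?sqr_ge0//; lra.
lra.
Qed.

Lemma sum_occupation_near_profile {R : realType} n i : (i <= n.+1)%N ->
  let E : R := \sum_(i <= j < n.+1) occupation (saddle n) j.+1%:R in
  `|E - profile (saddle n) i.+1%:R| <= 4 /\ 0 <= E <= 2 * Num.sqrt n.+1%:R.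
Proof.
move=> le_in; set t := saddle n; move=> E.
have t0 : 0 < t := saddle_gt0 n; have c0 := @curve_rate_gt0 R; have r0 := @sqrtS_gt0 R n.
have /andP[c1 c2] := @curve_rate_bounds R.
have /andP[h1 h2] := sum_occupation_bounds t i n.+1 t0 le_in; rewrite -/E in h1 h2.
have /andP[s1 _] := profile_step t i%:R t0; have /andP[_ f1] := occupation_itv t i%:R.
rewrite natr1 in s1.
(* The sum stops at [n + 1]; the rest of the profile is bounded since
   [t ^ 2 * (n + 1)] is constant. *)
have tail : profile t n.+2%:R <= 4.
  apply: le_trans (profile_le_expR t _ t0) _; rewrite ler_pdivrMr// expRN.
  have x0 : 0 < t * n.+1%:R by rewrite mulr_gt0// ltr0n.
  have xx : t * n.+1%:R <= expR (t * n.+2%:R).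
    apply: le_trans (expR_ge1Dx _).
    have : t * n.+1%:R <= t * n.+2%:R by rewrite ler_pM2l// ler_nat.
    lra.
  apply: (@le_trans _ _ (t * n.+1%:R)^-1).
    by rewrite lef_pV2 ?posrE ?expR_gt0.
  rewrite -[leLHS]mul1r ler_pdivrMr// saddle_mul_size /t /saddle.
  rewrite (_ : 4 * _ * _ = 4 * curve_rate R ^+ 2); last by field; rewrite gt_eqF.
  have : 0 <= (curve_rate R - 2^-1) * (curve_rate R + 2^-1) by rewrite mulr_ge0; lra.
  lra.
split; first by rewrite ler_norml; apply/andP; split; lra.
rewrite sumr_ge0/= => [|j _]; last by apply/ltW; case/andP: (occupation_itv t j.+1%:R).
apply: le_trans h2 _; apply: le_trans (le_profile t 0 _ t0 (ler0n _ i)) _.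
apply: le_trans (profile_le_expR t _ t0) _.
rewrite mulr0 oppr0 expR0 mul1r /t /saddle invf_div ler_pdivrMr// mulrAC.
by rewrite ler_peMl ?(ltW r0)//; lra.
Qed.

Lemma card_exists_le (T I : finType) (P : I -> pred T) :
  (#|[set x | [exists i, P i x]]%SET| <= \sum_i #|[set x | P i x]%SET|)%N.
Proof.
rewrite -sum1_card big_mkcond/=.
under [leqRHS]eq_bigr do rewrite -sum1_card big_mkcond/=.
rewrite exchange_big/=; apply: leq_sum => x _.
rewrite inE; case: existsP => // -[i Pi].
by rewrite (bigD1 i)//= inE Pi.
Qed.

Definition deviates {R : realType} n (rho : R) (i : nat) (A : {set 'I_n.+1}) : bool :=
  rho * Num.sqrt n.+1%:R < `|(parts_above i A)%:R - profile (saddle n) i.+1%:R|.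

(** A union bound over the [n + 2] thresholds, the two sides and the two signs of the
deviation.  With a tilt [v] of absolute value [u], the exponent contains the
mean with the coefficient [exp v - 1 - v], quadratic in [u], against
[u * rho * sqrt (n + 1)], linear in [u]. *)
Lemma deviating_card_bound {R : realType} n (rho u kap : R) :
  0 < u <= 4^-1 -> 8 * u <= rho ->
  2 * log_gen (saddle n) n.+1 <= (1 + kap) * (curve_rate R * Num.sqrt n.+1%:R) ->
  #|[set p : {set 'I_n.+1} * {set 'I_n.+1} | (pair_sum p <= n.+1)%N &&
      [exists i : 'I_n.+2, deviates n rho i p.1 || deviates n rho i p.2]]%SET|%:R
  <= 4 * n.+2%:R *
     expR ((2 + kap) * (curve_rate R * Num.sqrt n.+1%:R) + 1 - u * rho / 2 * Num.sqrt n.+1%:R).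
Proof.
move=> /andP[u0 u4] urho hG.
set r := Num.sqrt n.+1%:R; have r0 : 0 < r := sqrtS_gt0 n.
set bnd := expR _.
(* For the sign [(-1) ^ b], a deviation by [rho * r] in that direction means that
   the tilted count [(-1) ^ b * u * count] is at least [K b i]. *)
pose K (b : bool) (i : nat) : R := (-1) ^+ b * u * profile (saddle n) i.+1%:R + u * (rho * r).
pose P (j : 'I_n.+2 * (bool * bool)) (p : {set 'I_n.+1} * {set 'I_n.+1}) : bool :=
  (pair_sum p <= n.+1)%N &&
  (K j.2.1 j.1 <= (-1) ^+ j.2.1 * u * (parts_above j.1 (if j.2.2 then p.1 else p.2))%:R).
have Pbnd j : #|[set p | P j p]%SET|%:R <= bnd.
  case: j => [i [b side]].
  have le_in : (i <= n.+1)%N by rewrite -ltnS.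
  set v := (-1) ^+ b * u.
  have vu : `|v| = u by rewrite normrM normrX normrN1 expr1n mul1r gtr0_norm.
  have [close /andP[E0 E2]] := @sum_occupation_near_profile R n i le_in.
  set E := \sum_(_ <= _ < _) _ in close E0 E2.
  have t0 : 0 <= saddle n :> R by rewrite ltW ?saddle_gt0.
  apply: (@le_trans _ _ (expR (saddle n * n.+1%:R + 2 * log_gen (saddle n) n.+1
       + ((expR v - 1) * E - K b i)))).
    case: side; first exact: left_deviation_bound.
    exact: right_deviation_bound.
  rewrite ler_expR saddle_mul_size -/r.
  have q1 : (expR v - 1 - v) * E <= 2 * u ^+ 2 * (2 * r).
    apply: (@le_trans _ _ (2 * u ^+ 2 * E)).
      rewrite ler_wpM2r// -vu real_normK ?num_real//.
      by have : `|v| <= 2^-1; [lra|move/expR_le_quadratic; lra].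
    by rewrite ler_wpM2l// mulr_ge0// sqr_ge0.
  have q2 : v * (E - profile (saddle n) i.+1%:R) <= u * 4.
    by apply: le_trans (ler_norm _) _; rewrite normrM vu ler_pM2l.
  have q3 : 8 * u * (u * r) <= rho * (u * r) by rewrite ler_pM2r// mulr_gt0.
  have q4 : (expR v - 1) * E - K b i = (expR v - 1 - v) * E
     + v * (E - profile (saddle n) i.+1%:R) - u * (rho * r) by rewrite /K -/v; ring.
  rewrite q4; move: hG; rewrite -/r; lra.
apply: (@le_trans _ _ (\sum_(j : 'I_n.+2 * (bool * bool)) bnd)); last first.
  by rewrite sumr_const !card_prod card_bool card_ord -[leLHS]mulr_natl natrM [4 * _]mulrC.
apply: le_trans (ler_sum _ (fun j _ => Pbnd j)); rewrite -natr_sum ler_nat.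
apply: leq_trans (card_exists_le _ _ P); apply: subset_leq_card.
apply/fintype.subsetP => p; rewrite !inE => /andP[pn /existsP[i dev]].
have side A : deviates n rho i A ->
    exists b : bool, K b i <= (-1) ^+ b * u * (parts_above i A)%:R.
  rewrite /deviates -/r lter_normr => /orP[] h; [exists false|exists true];
    have := ler_wpM2l (ltW u0) (ltW h); rewrite /K ?expr0 ?expr1; lra.
case/orP: dev => /side[b hb].
  by apply/existsP; exists (i, (b, true)); rewrite /P pn.
by apply/existsP; exists (i, (b, false)); rewrite /P pn.
Qed.

(** * Convergence *)

Lemma sub_num_seqs (A B : set (seq nat)) : finite_set B -> A `<=` B ->
  (num_seqs A <= num_seqs B)%N.
Proof.
move=> Bfin AB; have Afin := sub_finite_set AB Bfin.
apply: uniq_leq_size; first exact: fset_uniq.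
by move=> s; rewrite !in_fset_set// !inE; exact: AB.
Qed.

Lemma num_seqsU_le (A B : set (seq nat)) : finite_set A -> finite_set B ->
  (num_seqs (A `|` B) <= num_seqs A + num_seqs B)%N.
Proof.
move=> Afin Bfin; rewrite -size_cat; apply: uniq_leq_size; first exact: fset_uniq.
move=> s; rewrite mem_cat !in_fset_set// ?finite_setU// !inE => -[sA|sB].
  by apply/orP; left; rewrite inE.
by apply/orP; right; rewrite inE.
Qed.

(** A shape that leaves the neighbourhood forces a deviation, by the contrapositive
of [shape_in_nbhd]. *)
Lemma far_shapes_le {R : realType} n (eps rho : R) : 0 < eps ->
  rho * Num.sqrt n.+1%:R + 1 <= eps * Num.sqrt n.+1%:R ->
  (num_seqs [set s | strongly_unimodal_seqs n.+1 s /\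
      ~ @renormalized_shape R s `<=` curve_nbhd eps (@f_d_dom R) (@f_d R)]
   <= #|[set p : {set 'I_n.+1} * {set 'I_n.+1} | (pair_sum p <= n.+1)%N &&
      [exists i : 'I_n.+2, deviates n rho i p.1 || deviates n rho i p.2]]%SET|)%N.
Proof.
move=> eps0 rho_eps; apply: (num_seqs_le_card _ _ (encode n.+1)).
- apply: sub_finite_set (finite_strongly_unimodal_seqs n.+1); by move=> s [].
- by move=> s1 s2; rewrite !inE => -[D1 _] [D2 _]; exact: encode_inj.
move=> s [D far]; rewrite inE pair_sum_encode_le//=.
apply: contrapT => /negP /fintype.existsPn close; apply: far.
apply: (shape_in_nbhd n.+1 eps rho) => // i X le_in XE.
have := close (Ordinal (le_in : (i < n.+2)%N)).
have [eL eR] := parts_above_encode n.+1 i s D.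
by rewrite negb_or /deviates eL eR -!leNgt => /andP[hL hR]; case: XE => ->.
Qed.

(** The cubic term of the exponential series dominates. *)
Lemma exp_beats_sqr {R : realType} (w e r : R) : 0 < w -> 0 < e -> 0 < r ->
  48 * expR 1 / (w ^+ 3 * e) <= r -> 8 * r ^+ 2 * expR (1 - w * r) <= e.
Proof.
move=> w0 e0 r0; rewrite ler_pdivrMr ?mulr_gt0 ?exprn_gt0// => h.
have := @expR_ge1Dxn R (w * r) 2 (mulr_ge0 (ltW w0) (ltW r0)).
rewrite expRB mulrA ler_pdivrMr ?expR_gt0// => h2.
apply: (@le_trans _ _ (e * ((w * r) ^+ 3 / 6))); last first.
  by rewrite ler_pM2l//; apply: le_trans h2; rewrite /= lerDr.
have := ler_wpM2l (sqr_ge0 r) h; rewrite exprMn; lra.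
Qed.

Theorem theorem1p1 (R : realType) (eps : R) (heps : 0 < eps) :
  (fun n : nat =>
     (num_seqs [set s | strongly_unimodal_seqs n s /\
        @renormalized_shape R s `<=` curve_nbhd eps (@f_d_dom R) (@f_d R)])%:R
     / (num_strongly_unimodal n)%:R : R) @ \oo --> (1 : R).
Proof.
apply/cvgrPdist_le => e e0.
pose rho := eps / 2; have rho0 : 0 < rho by rewrite divr_gt0.
(* The tilt [u] and then the relative errors [kap] and [dl] are chosen such that the
   gain [2 * w * sqrt n] of the deviation bound is at least twice the loss
   [(kap + 10 * dl) * x] of the estimates of [d(n)] and [Z], with [x <= 2 * sqrt n]. *)
pose u := Num.min 4^-1 (rho / 8).
have u0 : 0 < u by rewrite lt_min; apply/andP; split => //; rewrite divr_gt0.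
have u4 : u <= 4^-1 by rewrite ge_min lexx.
have urho : 8 * u <= rho.
  by have : u <= rho / 8; [rewrite ge_min lexx orbT|lra].
pose w := u * rho / 4; have w0 : 0 < w by rewrite divr_gt0// mulr_gt0.
pose kap := w / 4; have kap0 : 0 < kap by rewrite divr_gt0.
pose dl := Num.min 4^-1 (w / 40).
have d0 : 0 < dl by rewrite lt_min; apply/andP; split => //; rewrite divr_gt0.
have d4 : dl <= 4^-1 by rewrite ge_min lexx.
have dw : 10 * dl <= w / 4.
  by have : dl <= w / 40; [rewrite ge_min lexx orbT|lra].
have dP : 0 < dl <= 4^-1 by rewrite d0.
have tM : saddle n * n.+1%:R @[n --> \oo] --> (+oo : set_system R).
  apply/cvgryPge => A; have /cvgryPge/(_ (A * 2)) := @sqrtS_cvg R.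
  apply: filterS => n h; rewrite saddle_mul_size; have r0 := @sqrtS_gt0 R n.
  have /andP[c1 _] := @curve_rate_bounds R.
  have := ler_wpM2r (ltW r0) c1; lra.
have upper := log_gen_near 1 kap S ltr01 kap0 tM.
have lower := num_strongly_unimodal_lower dl dP.
have /cvgryPge large := @sqrtS_cvg R.
apply: near_inftyS; near=> n.
have hG : (1 - kap) * (curve_rate R * Num.sqrt n.+1%:R) / 1 <= 2 * log_gen (1 * saddle n) n.+1
    <= (1 + kap) * (curve_rate R * Num.sqrt n.+1%:R) / 1 by near: n.
move: hG; rewrite !divr1 mul1r => /andP[_ hG].
have hd : expR ((2 - 10 * dl) * (curve_rate R * Num.sqrt n.+1%:R))
      <= (num_strongly_unimodal n.+1)%:R by near: n.
have r1 : rho^-1 <= Num.sqrt n.+1%:R by near: n; exact: large.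
have r2 : 48 * expR 1 / (w ^+ 3 * e) <= Num.sqrt n.+1%:R by near: n; exact: large.
have r3 : 1 <= Num.sqrt n.+1%:R :> R by near: n; exact: large.
have r0 : 0 < Num.sqrt n.+1%:R :> R := sqrtS_gt0 n.
have rho_eps : rho * Num.sqrt n.+1%:R + 1 <= eps * Num.sqrt n.+1%:R.
  have := ler_wpM2l (ltW rho0) r1; rewrite mulfV ?gt_eqF// /rho; lra.
have far_le := far_shapes_le n eps rho heps rho_eps.
have card_le := deviating_card_bound n rho u kap ltac:(by rewrite u0) urho hG.
set far := num_seqs _ in far_le; set close := num_seqs _.
set d := num_strongly_unimodal n.+1 in hd *.
have close_le : (close <= d)%N.
  by apply: sub_num_seqs; [exact: finite_strongly_unimodal_seqs|move=> s []].
have all_le : (d <= close + far)%N.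
  have fin := finite_strongly_unimodal_seqs n.+1.
  apply: leq_trans (num_seqsU_le _ _ _ _); last 2 first.
  - by apply: sub_finite_set fin => s [].
  - by apply: sub_finite_set fin => s [].
  apply: sub_num_seqs.
    by rewrite finite_setU; split; apply: sub_finite_set fin => s [].
  by move=> s D; have [h|h] := pselect (@renormalized_shape R s `<=`
    curve_nbhd eps (@f_d_dom R) (@f_d R)); [left|right].
have dR0 : 0 < d%:R :> R by apply: lt_le_trans hd; exact: expR_gt0.
have far_small : far%:R <= e * d%:R.
  apply: (@le_trans _ _ (e * expR ((2 - 10 * dl) * (curve_rate R * Num.sqrt n.+1%:R)))); last first.
    by rewrite ler_pM2l.
  have : far%:R <= #|[set p : {set 'I_n.+1} * {set 'I_n.+1} | (pair_sum p <= n.+1)%N &&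
      [exists i : 'I_n.+2, deviates n rho i p.1 || deviates n rho i p.2]]%SET|%:R :> R.
    by rewrite ler_nat.
  move/le_trans; apply; apply: le_trans card_le _.
  set r := Num.sqrt n.+1%:R in r0 r2 r3 *; set x := curve_rate R * r.
  have xr : 0 < x <= 2 * r.
    have /andP[_ c2] := @curve_rate_bounds R.
    by rewrite /x mulr_gt0 ?curve_rate_gt0//= ler_pM2r.
  case/andP: xr => x0 xr.
  have n2 : 4 * n.+2%:R <= 8 * r ^+ 2.
    rewrite /r sqr_sqrtr// -!natrM ler_nat (_ : 8 = 4 * 2)%N// -mulnA leq_pmul2l//.
    by rewrite mul2n -addnn addSn ltnS leq_addl.
  have ex : expR ((2 + kap) * x + 1 - u * rho / 2 * r)
      <= expR (1 - w * r) * expR ((2 - 10 * dl) * x).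
    rewrite -expRD ler_expR.
    have h1 : (kap + 10 * dl) * x <= (w / 2) * (2 * r).
      apply: ler_pM => //; [rewrite addr_ge0 ?mulr_ge0 ?ltW//|exact: ltW|rewrite /kap; lra].
    have : u * rho / 2 = 2 * w by rewrite /w; lra.
    move=> ->; lra.
  apply: (@le_trans _ _ ((8 * r ^+ 2) * (expR (1 - w * r) * expR ((2 - 10 * dl) * x)))).
    by apply: ler_pM => //; rewrite ?expR_ge0.
  rewrite mulrA ler_pM2r ?expR_gt0//; exact: exp_beats_sqr.
have -> : 1 - close%:R / d%:R = (d%:R - close%:R) / d%:R :> R.
  by rewrite mulrBl mulfV ?gt_eqF.
rewrite normf_div (gtr0_norm dR0) ler_pdivrMr// ger0_norm ?subr_ge0 ?ler_nat//.
apply: le_trans far_small; rewrite lerBlDl -natrD ler_nat//.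
Unshelve. all: end_near. Qed.
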